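(* Let $\{\mathcal{I},F,\{f_i\}_{i=1}^N,\{\Delta_i\}_{i=1}^N\}$ be the branching function system associated to a slow continued fraction algorithm. There is a unital embedding $\psi_F:\mathcal{O}_N\to\mathcal{O}_2\rtimes_\theta\mathbb{Z}_2$ such that $$\tilde\pi_{F_B}\circ\psi_F=\pi_F$$ as representations of $\mathcal{O}_N$ on $\ell^2(\mathcal{I})$.
   Context: $\mathcal{O}_N$ ($2\le N<\infty$) is the universal $C^*$-algebra generated by $S_1,\dots,S_N$ with $S_i^*S_j=\delta_{ij}1$, $\sum_{i=1}^N S_iS_i^*=1$. An embedding is an injective $*$-homomorphism. A branching function system (BFS) of order $N$ on a set $\Omega$ is a family of injective maps $f_i:\Omega\to\Omega$ ($1\le i\le N$) with pairwise disjoint ranges $\Delta_i=f_i(\Omega)$ whose union is $\Omega$; $F$ is the map equal to $f_i^{-1}$ on $\Delta_i$. It induces a representation $\pi_F$ of $\mathcal{O}_N$ on $\ell^2(\Omega)$ (orthonormal basis $\{e_\omega:\omega\in\Omega\}$) by $\pi_F(S_i)e_\omega=e_{f_i(\omega)}$. $\mathrm{PGL}_2(\mathbb{Z})$ is the group of $2\times2$ integer matrices of determinant $\pm1$ modulo $\pm$ identity, viewed as fractional linear transformations. A unimodular interval is $[\frac pq,\frac{p'}{q'}]\subset[0,1]$ with reduced fractions satisfying $pq'-p'q=-1$. A unimodular partition is a finite collection of unimodular intervals with union $[0,1]$, any two of which meet in at most one point. A slow continued fraction algorithm (SCFA) is a finite collection $h_1,\dots,h_N:[0,1]\to[0,1]$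 ($N\ge2$) of fractional linear transformations in $\mathrm{PGL}_2(\mathbb{Z})$ whose images $h_i([0,1])$ form a unimodular partition, indexed from left to right. Let $\mathcal{I}=[0,1]\setminus\mathbb{Q}$; the BFS associated to the SCFA is the BFS on $\mathcal{I}$ formed by the restrictions $f_i=h_i|_{\mathcal{I}}$. The flip-flop automorphism $\theta$ of $\mathcal{O}_2$ is given by $\theta(S_1)=S_2$, $\theta(S_2)=S_1$; it defines an action of $\mathbb{Z}_2=\mathbb{Z}/2\mathbb{Z}$, with crossed product $\mathcal{O}_2\rtimes_\theta\mathbb{Z}_2$, generated by $\mathcal{O}_2$ and a self-adjoint unitary $U_\theta$ with $U_\theta AU_\theta^*=\theta(A)$ for $A\in\mathcal{O}_2$. $F_B$ denotes the SCFA with $N=2$ and maps $x\mapsto\frac{x}{1+x}$ (image $[0,\frac12]$) and $x\mapsto\frac{1}{2-x}$ (image $[\frac12,1]$), so $\pi_{F_B}(S_1)e_x=e_{x/(1+x)}$ and $\pi_{F_B}(S_2)e_x=e_{1/(2-x)}$ on $\ell^2(\mathcal{I})$. $\tilde\pi_{F_B}$ is the representation of $\mathcal{O}_2\rtimes_\theta\mathbb{Z}_2$ on $\ell^2(\mathcal{I})$ extending $\pi_{F_B}$ and satisfying $\tilde\pi_{F_B}(U_\theta)e_x=e_{1-x}$ for $x\in\mathcal{I}$. *)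

(* Defs.v *)
From HB Require Import structures.
From mathcomp Require Import all_boot all_order all_algebra.
From mathcomp Require Import complex.
From mathcomp Require Import mathcomp_extra boolp classical_sets functions.
From mathcomp Require Import cardinality set_interval reals ereal normedtype esum.
From mathcomp Require Import ring lra.

Set Implicit Arguments.
Unset Strict Implicit.
Unset Printing Implicit Defensive.
Import Order.TTheory GRing.Theory Num.Theory.
Import ComplexField.Normc.
Local Open Scope classical_set_scope.
Local Open Scope complex_scope.
Local Open Scope ring_scope.

(* Unital C*-algebras over the complex numbers R[i].  The norm is a separate
   real-valued field, since the library has no join of GRing.Algebra with its
   normed modules. *)
HB.mixin Record isCStarAlgebra (R : realType) A of GRing.Algebra R[i] A := {
  star : A -> A;
  cnorm : A -> R;
  starD : forall a b : A, star (a + b) = star a + star b;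
  starZ : forall (k : R[i]) (a : A), star (k *: a) = k^* *: star a;
  starM : forall a b : A, star (a * b) = star b * star a;
  starK : forall a : A, star (star a) = a;
  cnormD : forall a b : A, cnorm (a + b) <= cnorm a + cnorm b;
  cnormZ : forall (k : R[i]) (a : A), cnorm (k *: a) = normc k * cnorm a;
  cnorm_eq0 : forall a : A, cnorm a = 0 -> a = 0;
  cnormM : forall a b : A, cnorm (a * b) <= cnorm a * cnorm b;
  cnorm_star : forall a : A, cnorm (star a * a) = cnorm a ^+ 2;
  cnorm_complete : forall u : nat -> A,
    (forall e : R, 0 < e -> exists n : nat, forall p q : nat,
       (n <= p)%N -> (n <= q)%N -> cnorm (u p - u q) < e) ->
    exists l : A, forall e : R, 0 < e -> exists n : nat, forall p : nat,
       (n <= p)%N -> cnorm (u p - l) < e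
}.

#[short(type="cstarAlgType")]
HB.structure Definition CStarAlgebra (R : realType) :=
  { A of isCStarAlgebra R A & GRing.Algebra R[i] A }.

Section CStar.
Context {R : realType}.
Implicit Types A B : cstarAlgType R.

(* A unital *-homomorphism is a {lrmorphism A -> B} satisfying star_morphism. *)
Definition star_morphism A B (phi : A -> B) : Prop :=
  forall a : A, phi (star a) = star (phi a).

Definition cnorm_closed A (P : set A) : Prop :=
  forall (u : nat -> A) (l : A), (forall n, P (u n)) ->
    (forall e : R, 0 < e -> exists n : nat, forall p : nat,
       (n <= p)%N -> cnorm (u p - l) < e) ->
    P l.

Definition star_subalgebra A (P : set A) : Prop :=
  [/\ forall a b, P a -> P b -> P (a + b),
      forall (k : R[i]) a, P a -> P (k *: a),
      forall a b, P a -> P b -> P (a * b)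
    & forall a, P a -> P (star a)].

Definition generates A (G : set A) : Prop :=
  forall P : set A, star_subalgebra P -> cnorm_closed P -> G `<=` P ->
    P = setT.

Definition cuntz_family N A (S : 'I_N -> A) : Prop :=
  (forall i j, star (S i) * S j = (i == j)%:R) /\
  \sum_(i < N) S i * star (S i) = 1.

(* A, with the elements S i, is the universal C*-algebra O_N. *)
Record cuntz_algebra N A (S : 'I_N -> A) : Prop := CuntzAlgebra {
  cuntz_relations : cuntz_family S;
  cuntz_generates : generates (range S);
  cuntz_universal : forall (B : cstarAlgType R) (T : 'I_N -> B), cuntz_family T ->
    exists phi : {lrmorphism A -> B},
      star_morphism phi /\ forall i, phi (S i) = T i;
  cuntz_unique : forall (B : cstarAlgType R) (phi psi : {lrmorphism A -> B}),
    star_morphism phi -> star_morphism psi ->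
    (forall i, phi (S i) = psi (S i)) -> phi =1 psi
}.

Record flip_flop A (S : 'I_2 -> A) (theta : A -> A) : Prop := FlipFlop {
  flip_flop_bij : bijective theta;
  flip_flop_star : star_morphism theta;
  flip_flop0 : theta (S ord0) = S ord_max;
  flip_flop1 : theta (S ord_max) = S ord0
}.

(* U is a self-adjoint unitary implementing theta on the image of iota. *)
Record covariant A B (theta : A -> A) (iota : A -> B) (U : B) : Prop :=
  Covariant {
  covariant_star : star_morphism iota;
  covariant_sa : star U = U;
  covariant_unitary : star U * U = 1 /\ U * star U = 1;
  covariant_conj : forall a, U * iota a * star U = iota (theta a)
}.

(* B is the crossed product of A by the Z/2-action of an automorphism theta
   with theta \o theta = id, for the embedding iota and the unitary U. *)
Record crossed_product_Z2 A B (theta : A -> A) (iota : {lrmorphism A -> B})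
    (U : B) : Prop := CrossedProductZ2 {
  crossed_covariant : covariant theta iota U;
  crossed_generates : generates (range iota `|` [set U]);
  crossed_universal : forall (C : cstarAlgType R) (phi : {lrmorphism A -> C}) (V : C),
    covariant theta phi V ->
    exists Phi : {lrmorphism B -> C},
      [/\ star_morphism Phi, forall a, Phi (iota a) = phi a & Phi U = V];
  crossed_unique : forall (C : cstarAlgType R) (Phi Psi : {lrmorphism B -> C}),
    star_morphism Phi -> star_morphism Psi ->
    (forall a, Phi (iota a) = Psi (iota a)) -> Phi U = Psi U -> Phi =1 Psi
}.

End CStar.

Section Ell2.
Context {R : realType} (W : choiceType).
Local Notation C := R[i].

Definition sqsum (f : W -> C) : \bar R :=
  (\esum_(w in [set: W]) (normc (f w) ^+ 2)%:E)%E.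

Definition square_summable : {pred W -> C^o} :=
  fun f => (sqsum f < +oo)%E.

Let sqr_normc_ge0 (f : W -> C) w : (0 <= (normc (f w) ^+ 2)%:E)%E.
Proof. by rewrite lee_fin sqr_ge0. Qed.

Let normc_ge0 (z : C) : 0 <= normc z.
Proof. by case: z => a b; rewrite /normc sqrtr_ge0. Qed.

Let esumZ (f : W -> \bar R) (c : R) : 0 <= c -> (forall w, 0 <= f w)%E ->
  (\esum_(w in [set: W]) f w < +oo)%E ->
  (\esum_(w in [set: W]) (c%:E * f w) < +oo)%E.
Proof.
move=> c0 f0 hf.
apply: (@le_lt_trans _ _ (c%:E * \esum_(w in [set: W]) f w)%E); last first.
  by apply: lte_mul_pinfty => //; rewrite lee_fin.
apply: ge_ereal_sup => _ [X [finX _] <-].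
rewrite -ge0_mule_fsumr //.
apply: lee_pmul => //; first by rewrite fsume_ge0.
by apply: ereal_sup_ubound; exists X.
Qed.

Lemma square_summable_submod : submod_closed square_summable.
Proof.
split=> [|a f g]; rewrite !unfold_in /sqsum.
  by rewrite esum1 ?ltry // => w _; rewrite normc0 expr0n.
move=> hf hg.
pose F w : \bar R := ((2 * normc a ^+ 2)%:E * (normc (f w) ^+ 2)%:E
  + 2%:E * (normc (g w) ^+ 2)%:E)%E.
apply: (@le_lt_trans _ _ (\esum_(w in [set: W]) F w)%E).
  apply: le_esum => w _; rewrite /F -!EFinM -EFinD lee_fin.
  have h1 : normc ((a *: f + g) w) <= normc a * normc (f w) + normc (g w).
    by rewrite -normcM; exact: le_normcD.
  apply: (@le_trans _ _ ((normc a * normc (f w) + normc (g w)) ^+ 2)).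
    by rewrite lerXn2r ?nnegrE ?addr_ge0 ?mulr_ge0.
  rewrite -subr_ge0.
  have := sqr_ge0 (normc a * normc (f w) - normc (g w)).
  by congr (_ <= _); ring.
have c0 : 0 <= 2 * normc a ^+ 2 by rewrite mulr_ge0 ?sqr_ge0.
rewrite /F esumD; last 2 first.
- by move=> w _; rewrite mule_ge0 ?lee_fin ?sqr_ge0.
- by move=> w _; rewrite mule_ge0 ?lee_fin ?sqr_ge0.
by rewrite lte_add_pinfty // esumZ // lee_fin.
Qed.

HB.instance Definition _ :=
  GRing.isSubmodClosed.Build C (W -> C^o) square_summable
    square_summable_submod.

Record ell2 := Ell2 {
  ell2_fun :> W -> C^o;
  ell2P : ell2_fun \in square_summable
}.
HB.instance Definition _ := [isSub for ell2_fun].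
HB.instance Definition _ := [Choice of ell2 by <:].
HB.instance Definition _ := [SubChoice_isSubLmodule of ell2 by <:].

Definition ell2norm (f : ell2) : R := Num.sqrt (fine (sqsum f)).

(* Unconditional sum of an absolutely summable family. *)
Definition rsum (g : W -> R) : R :=
  fine (\esum_(w in [set: W]) (Num.max (g w) 0)%:E)%E -
  fine (\esum_(w in [set: W]) (Num.max (- g w) 0)%:E)%E.

Definition csum (g : W -> C) : C :=
  rsum (fun w => complex.Re (g w)) +i* rsum (fun w => complex.Im (g w)).

Definition ell2_inner (f g : ell2) : C := csum (fun w => f w * (g w)^*).

Fact delta_square_summable (w : W) :
  (fun v => (v == w)%:R : C^o) \in square_summable.
Proof.
rewrite unfold_in /sqsum (esumID [set w]) //; last first.
  by move=> v _; rewrite lee_fin sqr_ge0.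
rewrite setTI esum_set1 ?lee_fin ?sqr_ge0 // esum1 ?adde0 ?ltry //.
move=> v [_ /= /eqP /negbTE ->].
by rewrite normc0 expr0n.
Qed.

Definition ell2_basis (w : W) : ell2 := Ell2 (delta_square_summable w).

End Ell2.

Section Representation.
Context {R : realType} (W : choiceType) (A : cstarAlgType R).
Local Notation H := (@ell2 R W).

Definition bounded_op (T : H -> H) : Prop :=
  exists M : R, forall f : H, ell2norm (T f) <= M * ell2norm f.

Record representation (pi : A -> {linear H -> H}) : Prop := Representation {
  rep_bounded : forall a, bounded_op (pi a);
  repD : forall a b f, pi (a + b) f = pi a f + pi b f;
  repZ : forall (k : R[i]) a f, pi (k *: a) f = k *: pi a f;
  repM : forall a b f, pi (a * b) f = pi a (pi b f);
  rep1 : forall f, pi 1 f = f;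
  rep_star : forall a f g,
    ell2_inner (pi (star a) f) g = ell2_inner f (pi a g)
}.
End Representation.

Record bfs (N : nat) (W : Type) := BFS {
  bfs_map :> 'I_N -> W -> W;
  bfs_inj : forall i, injective (bfs_map i);
  bfs_disjoint : trivIset setT (fun i => range (bfs_map i));
  bfs_cover : \bigcup_i range (bfs_map i) = setT
}.

Definition bfs_induces (R : realType) (N : nat) (W : choiceType)
    (A : cstarAlgType R) (S : 'I_N -> A) (f : bfs N W)
    (pi : A -> {linear ell2 W -> @ell2 R W}) : Prop :=
  forall i w, pi (S i) (ell2_basis w) = ell2_basis (f i w).

Section SCFA.
Context {R : realType}.

Definition moebius_den (M : 'M[int]_2) (x : R) : R :=
  (M ord_max ord0)%:~R * x + (M ord_max ord_max)%:~R.

Definition moebius (M : 'M[int]_2) (x : R) : R :=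
  ((M ord0 ord0)%:~R * x + (M ord0 ord_max)%:~R) / moebius_den M x.

Definition unimodular_interval (J : set R) : Prop :=
  exists p q p' q' : int,
    [/\ 0 < q /\ 0 < q', coprimez p q /\ coprimez p' q',
        p * q' - p' * q = -1,
        J = `[p%:~R / q%:~R, p'%:~R / q'%:~R]%classic
      & J `<=` `[0, 1]%classic].

Definition unimodular_partition (N : nat) (J : 'I_N -> set R) : Prop :=
  [/\ forall i, unimodular_interval (J i),
      \bigcup_i J i = `[0, 1]%classic
    & forall i j, i != j -> is_subset1 (J i `&` J j)].

(* Elements of PGL_2(Z) are given by representatives M in GL_2(Z); division
   being total, the nonvanishing of the denominator on [0, 1] is explicit. *)
Record scfa (N : nat) := SCFA {
  scfa_mx :> 'I_N -> 'M[int]_2;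
  scfa_size : (2 <= N)%N;
  scfa_det : forall i, \det (scfa_mx i) = 1 \/ \det (scfa_mx i) = -1;
  scfa_den : forall i x, 0 <= x <= 1 -> moebius_den (scfa_mx i) x != 0;
  scfa_partition :
    unimodular_partition (fun i => moebius (scfa_mx i) @` `[0, 1]%classic);
  scfa_ordered : forall i j : 'I_N, (i < j)%N ->
    forall x y, 0 <= x <= 1 -> 0 <= y <= 1 ->
      moebius (scfa_mx i) x <= moebius (scfa_mx j) y
}.

Definition unit_irrationals : set R :=
  `[0, 1]%classic `\` rational.

Definition irr : Type := {x : R | x \in unit_irrationals}.
HB.instance Definition _ := SubChoice.on irr.
End SCFA.
Arguments irr : clear implicits.

Lemma itv_ccE (R : realType) (a b x : R) :
  `[a, b]%classic x = (a <= x <= b) :> Prop.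
Proof. by rewrite /= in_itv. Qed.

Section Moebius.
Context {R : realType}.
Implicit Types (M : 'M[int]_2) (x y : R).

Lemma moebius_detE M : \det M =
  M ord0 ord0 * M ord_max ord_max - M ord0 ord_max * M ord_max ord0.
Proof.
rewrite (expand_det_row _ ord0) !big_ord_recl big_ord0 addr0 /cofactor !det_mx11.
rewrite !mxE /= !expr0 !expr1 mul1r mulN1r mulrN.
by congr (_ * M _ _ - M _ _ * M _ _); apply: val_inj.
Qed.

Lemma moebius_det_neq0 M : \det M = 1 \/ \det M = -1 ->
  (M ord0 ord0)%:~R * (M ord_max ord_max)%:~R -
  (M ord0 ord_max)%:~R * (M ord_max ord0)%:~R != 0 :> R.
Proof.
move=> h; rewrite -!intrM -intrB intr_eq0 -moebius_detE.
by case: h => ->.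
Qed.

Lemma rational_int (n : int) : rational (n%:~R : R).
Proof. by exists n%:~R => //; rewrite ratr_int. Qed.

Lemma rationalB x y : rational x -> rational y -> rational (x - y).
Proof. by move=> [p _ <-] [q _ <-]; exists (p - q) => //; rewrite rmorphB. Qed.

Lemma rationalD x y : rational x -> rational y -> rational (x + y).
Proof. by move=> [p _ <-] [q _ <-]; exists (p + q) => //; rewrite rmorphD. Qed.

Lemma rationalM x y : rational x -> rational y -> rational (x * y).
Proof. by move=> [p _ <-] [q _ <-]; exists (p * q) => //; rewrite rmorphM. Qed.

Lemma rational_div x y : rational x -> rational y -> rational (x / y).
Proof. by move=> [p _ <-] [q _ <-]; exists (p / q) => //; rewrite fmorph_div. Qed.

Lemma moebius_rational M x : rational x -> rational (moebius M x).
Proof.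
move=> rx; apply: rational_div;
  by apply: rationalD; [apply: rationalM => //|]; exact: rational_int.
Qed.

Lemma moebius_inj M x y : \det M = 1 \/ \det M = -1 ->
  moebius_den M x != 0 -> moebius_den M y != 0 ->
  moebius M x = moebius M y -> x = y.
Proof.
move=> /moebius_det_neq0 D dx dy /eqP.
rewrite /moebius eqr_div // => /eqP e; apply/eqP; rewrite -subr_eq0.
have : ((M ord0 ord0)%:~R * (M ord_max ord_max)%:~R -
  (M ord0 ord_max)%:~R * (M ord_max ord0)%:~R) * (x - y) = 0 :> R.
  by move/eqP: e; rewrite -subr_eq0 => /eqP <-; rewrite /moebius_den; ring.
by move/eqP; rewrite mulf_eq0 (negbTE D).
Qed.

Lemma moebius_irrational M x : \det M = 1 \/ \det M = -1 ->
  moebius_den M x != 0 -> ~ rational x -> ~ rational (moebius M x).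
Proof.
move=> /moebius_det_neq0 D dx irx rr; set r := moebius M x in rr.
have e : (M ord0 ord0)%:~R * x + (M ord0 ord_max)%:~R = r * moebius_den M x.
  by rewrite /r /moebius divfK.
have e2 : ((M ord0 ord0)%:~R - r * (M ord_max ord0)%:~R) * x =
    r * (M ord_max ord_max)%:~R - (M ord0 ord_max)%:~R.
  move/eqP: e; rewrite -subr_eq0 => /eqP e; apply/eqP; rewrite -subr_eq0.
  by apply/eqP; rewrite -e /moebius_den; ring.
have [z|nz] := eqVneq ((M ord0 ord0)%:~R - r * (M ord_max ord0)%:~R) 0.
  move: e2; rewrite z mul0r => /esym/eqP; rewrite subr_eq0 => /eqP e2.
  move/eqP: D; apply; rewrite -e2.
  by move/eqP: z; rewrite subr_eq0 => /eqP ->; ring.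
apply: irx; rewrite -(mulKf nz x) e2 mulrC; apply: rational_div.
  by apply: rationalB; [apply: rationalM => //|]; exact: rational_int.
by apply: rationalB; [|apply: rationalM => //]; exact: rational_int.
Qed.

End Moebius.

Section SCFABFS.
Context {R : realType} (N : nat) (h : @scfa R N).

Lemma irrP (x : irr R) : 0 <= val x <= 1 /\ ~ rational (val x).
Proof.
by case: x => x /= /[!inE] -[/=]; rewrite in_itv /= => xI nx; split.
Qed.

Lemma scfa_in01 i (x : R) : 0 <= x <= 1 -> 0 <= moebius (h i) x <= 1.
Proof.
move=> x01; case: (scfa_partition h) => /(_ i) [p [q [p' [q' [_ _ _ _ sub]]]]] _ _.
have := sub (moebius (h i) x); rewrite /= in_itv; apply.
by exists x; rewrite //= in_itv.
Qed.

Fact scfa_irr i (x : irr R) : moebius (h i) (val x) \in unit_irrationals.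
Proof.
have [x01 xN] := irrP x; rewrite inE; split; first by rewrite /= in_itv scfa_in01.
exact: moebius_irrational (scfa_det h i) (scfa_den h i x01) xN.
Qed.

Definition scfa_irr_map (i : 'I_N) (x : irr R) : irr R :=
  exist _ (moebius (h i) (val x)) (scfa_irr i x).

Fact scfa_irr_map_inj i : injective (scfa_irr_map i).
Proof.
move=> x y /(congr1 val) /= e; apply: val_inj.
have [x01 _] := irrP x; have [y01 _] := irrP y.
by apply: moebius_inj e; [exact: scfa_det|exact: scfa_den|exact: scfa_den].
Qed.

Let disj_lt (i j : 'I_N) x y : (i < j)%N ->
  scfa_irr_map i x <> scfa_irr_map j y.
Proof.
move=> ij /(congr1 val) /= e.
have [x01 xN] := irrP x; have [y01 yN] := irrP y.
case: (scfa_partition h) => /(_ i) [p [q [p' [q' [[q0 q'0] _ pq Je Jsub]]]]] _ _.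
set z := moebius (h i) (val x) in e.
have nz : ~ rational z.
  exact: moebius_irrational (scfa_det h i) (scfa_den h i x01) xN.
have q0R : 0 < q%:~R :> R by rewrite ltr0z.
have q'0R : 0 < q'%:~R :> R by rewrite ltr0z.
have lepq : p%:~R / q%:~R <= p'%:~R / q'%:~R :> R.
  rewrite ler_pdivrMr // mulrAC ler_pdivlMr // -!intrM ler_int.
  by rewrite -subr_le0 pq.
have : (moebius (h i) @` `[0, 1]%classic) (p'%:~R / q'%:~R : R).
  by rewrite Je /= in_itv /= lepq lexx.
case=> t; rewrite /= in_itv /= => t01 et.
have le1 := scfa_ordered h ij t01 y01.
have : (moebius (h i) @` `[0, 1]%classic) z.
  by exists (val x); rewrite //= in_itv.
rewrite Je /= in_itv /= => /andP[_ le2].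
apply: nz; rewrite (_ : z = p'%:~R / q'%:~R).
  by apply: rational_div; exact: rational_int.
by apply/eqP; rewrite eq_le le2 -et e.
Qed.

Fact scfa_disjoint : trivIset setT (fun i => range (scfa_irr_map i)).
Proof.
move=> i j _ _ [z [[x _ <-] [y _ e]]]; apply: val_inj.
case: (ltngtP i j) => // ij; first by case: (disj_lt ij (esym e)).
by case: (disj_lt ij e).
Qed.

Fact scfa_cover : \bigcup_i range (scfa_irr_map i) = setT.
Proof.
apply/seteqP; split=> // y _; have [y01 yN] := irrP y.
case: (scfa_partition h) => _ cov _.
have : `[0, 1]%classic (val y) by rewrite /= in_itv.
rewrite -cov => -[i _ [x x01 e]]; exists i => //.
have xI : x \in unit_irrationals.
  by rewrite inE; split=> // rx; apply: yN; rewrite -e; exact: moebius_rational.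
by exists (exist _ x xI) => //; apply: val_inj.
Qed.

Definition scfa_bfs : bfs N (irr R) :=
  BFS scfa_irr_map_inj scfa_disjoint scfa_cover.

End SCFABFS.

Section FareyMap.
Context {R : realType}.

(* Matrices of x / (1 + x) and 1 / (2 - x); see FB_moebius0, FB_moebius1. *)
Definition FB_mx (i : 'I_2) : 'M[int]_2 :=
  if i == ord0
  then \matrix_(r, c) (if (r == ord0) && (c == ord_max) then 0 else 1)
  else \matrix_(r, c) (if r == ord0 then (c == ord_max)%:R
                       else if c == ord0 then -1 else 2).

Lemma FB_moebius0 (x : R) : moebius (FB_mx ord0) x = x / (1 + x).
Proof.
rewrite /moebius /moebius_den /FB_mx !mxE /=.
by rewrite mulr0z mulr1z !mul1r addr0 addrC. Qed.

Lemma FB_moebius1 (x : R) : moebius (FB_mx ord_max) x = 1 / (2 - x).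
Proof.
by rewrite /moebius /moebius_den /FB_mx !mxE /= mul0r add0r mulN1r addrC.
Qed.

Let I2P (i : 'I_2) : i = ord0 \/ i = ord_max.
Proof. by case: i => -[|[|//]] lt; [left|right]; exact: val_inj. Qed.

Fact FB_det i : \det (FB_mx i) = 1 \/ \det (FB_mx i) = -1.
Proof.
left; rewrite moebius_detE.
by case: (I2P i) => ->; rewrite /FB_mx !mxE.
Qed.

Fact FB_den i (x : R) : 0 <= x <= 1 -> moebius_den (FB_mx i) x != 0.
Proof.
move=> /andP[x0 x1]; rewrite /moebius_den.
case: (I2P i) => ->; rewrite /FB_mx !mxE /= gt_eqF //; lra.
Qed.

Lemma FB_image0 : moebius (FB_mx ord0) @` `[0, 1]%classic =
  `[0, 1 / 2]%classic :> set R.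
Proof.
apply/seteqP; split=> [_ [x + <-]|y]; rewrite !itv_ccE => /andP[y0 y1].
  have d : 0 < 1 + x by lra.
  rewrite FB_moebius0; apply/andP; split; first by rewrite divr_ge0 // ltW.
  by rewrite ler_pdivrMr //; lra.
have d : 1 - y != 0 by rewrite gt_eqF //; lra.
have d0 : 0 < 1 - y by lra.
exists (y / (1 - y)).
  by rewrite itv_ccE divr_ge0 ?(ltW d0) //= ler_pdivrMr //; lra.
by rewrite FB_moebius0; field; rewrite d /= subrK oner_neq0.
Qed.

Lemma FB_image1 : moebius (FB_mx ord_max) @` `[0, 1]%classic =
  `[1 / 2, 1]%classic :> set R.
Proof.
apply/seteqP; split=> [_ [x + <-]|y]; rewrite !itv_ccE => /andP[y0 y1].
  have d : 0 < 2 - x by lra.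
  rewrite FB_moebius1 ler_pdivlMr // ler_pdivrMr //; apply/andP; split; lra.
have d : y != 0 by rewrite gt_eqF //; lra.
have d0 : 0 < y by lra.
exists (2 - 1 / y).
  rewrite itv_ccE subr_ge0 ler_pdivrMr // lerBlDr -lerBlDl ler_pdivlMr //.
  by apply/andP; split; lra.
by rewrite FB_moebius1 opprB addrC subrK !div1r invrK.
Qed.

Fact FB_partition : @unimodular_partition R 2
  (fun i => moebius (FB_mx i) @` `[0, 1]%classic).
Proof.
split=> [i||i j].
- case: (I2P i) => ->; rewrite ?FB_image0 ?FB_image1.
    exists 0, 1, 1, 2; split => //; first by rewrite divr1.
    by move=> x; rewrite !itv_ccE => /andP[]; lra.
  exists 1, 2, 1, 1; split => //; first by rewrite divr1.
  by move=> x; rewrite !itv_ccE => /andP[]; lra.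
- apply/seteqP; split=> [x [i _]|x].
    by case: (I2P i) => ->; rewrite ?FB_image0 ?FB_image1 !itv_ccE
      => /andP[? ?]; apply/andP; split; lra.
  rewrite itv_ccE => /andP[x0 x1]; case: (lerP x (1 / 2)) => hx.
    by exists ord0 => //; rewrite FB_image0 itv_ccE x0.
  by exists ord_max => //; rewrite FB_image1 itv_ccE x1 ltW.
- case: (I2P i) => ->; case: (I2P j) => -> // _ x y;
    rewrite FB_image0 FB_image1 => -[+ +] [+ +]; rewrite !itv_ccE;
    move=> /andP[? ?] /andP[? ?] /andP[? ?] /andP[? ?]; lra.
Qed.

Fact FB_ordered (i j : 'I_2) : (i < j)%N ->
  forall x y : R, 0 <= x <= 1 -> 0 <= y <= 1 ->
    moebius (FB_mx i) x <= moebius (FB_mx j) y.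
Proof.
case: (I2P i) => ->; case: (I2P j) => -> // _ x y hx hy.
have := FB_image0; have := FB_image1.
move=> /seteqP[/(_ (moebius (FB_mx ord_max) y)) h1 _].
move=> /seteqP[/(_ (moebius (FB_mx ord0) x)) h0 _].
have := h0 (ex_intro2 _ _ x _ erefl); have := h1 (ex_intro2 _ _ y _ erefl).
rewrite !itv_ccE => /(_ hy) /andP[? ?] /(_ hx) /andP[? ?]; lra.
Qed.

Definition FB : @scfa R 2 :=
  SCFA (leqnn 2) FB_det FB_den FB_partition FB_ordered.

Fact flip_irr (x : irr R) : 1 - val x \in unit_irrationals.
Proof.
have [/andP[x0 x1] xN] := irrP x; rewrite inE; split.
  by rewrite itv_ccE; apply/andP; split; lra.
move=> r; apply: xN; rewrite (_ : val x = 1%:~R - (1 - val x)).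
  by apply: rationalB => //; exact: rational_int.
by rewrite subKr.
Qed.

Definition flip (x : irr R) : irr R := exist _ (1 - val x) (flip_irr x).

End FareyMap.
Arguments FB : clear implicits.

(* Main.v *)
(** Each branch of the algorithm is a word in the two inverse branches of the
    Farey map, possibly preceded by the flip [x |-> 1 - x].  The words form a
    complete prefix code because the ranges of the branches partition the
    irrationals, so the elements [T i = iota (S2 word) * U ^+ s] of the crossed
    product satisfy the Cuntz relations, and universality gives the morphism.
    The intertwining relation holds on basis vectors for the generators, hence
    everywhere by passing to matrix coefficients.

    Injectivity is the simplicity of the Cuntz algebra, obtained without
    spectral theory: a polynomial [a] of degree at most [k] in the generators
    is a sum of [2 k + 1] homogeneous components, each a compression
    [V^* a W] of [a] by isometries of the algebra, and on a homogeneous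
    component a morphism [phi] is isometric, because matrix algebras have a
    unique C*-norm.  So [|a| <= (2 k + 1) |phi a|]; applied to the powers of
    [a^* a] this linear growth disappears in the limit, and [|a| <= |phi a|]. *)

Require Import Defs.
From HB Require Import structures.
From mathcomp Require Import all_boot all_order all_algebra.
From mathcomp Require Import complex.
From mathcomp Require Import boolp classical_sets reals.
From mathcomp Require Import fsbigop ereal esum.
From mathcomp Require Import ring lra zify.

Set Implicit Arguments.
Unset Strict Implicit.
Unset Printing Implicit Defensive.
Import Order.TTheory GRing.Theory Num.Theory.
Import ComplexField.Normc.
Local Open Scope classical_set_scope.
Local Open Scope complex_scope.
Local Open Scope ring_scope.

(** * Growth of powers of real numbers *)

Section RealPowers.
Context {R : realType}.
Implicit Types x y c q e : R.

Lemma mul_natr_unbounded e c : 0 < e -> exists n : nat, c < e * n%:R.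
Proof.
move=> e0; exists (Num.truncn (c / e)).+1.
by rewrite mulrC -ltr_pdivrMr // truncnS_gt.
Qed.

Lemma bernoulli_le e n : 0 <= e -> 1 + e * n%:R <= (1 + e) ^+ n.
Proof.
move=> e0; elim: n => [|n IH]; first by rewrite mulr0 addr0 expr0.
rewrite exprS; apply: le_trans (ler_wpM2l _ IH); last by rewrite addr_ge0.
rewrite -natr1 -subr_ge0.
have -> : (1 + e) * (1 + e * n%:R) - (1 + e * (n%:R + 1)) = e ^+ 2 * n%:R.
  by ring.
by rewrite mulr_ge0 // sqr_ge0.
Qed.

Lemma geometric_small q e : 0 <= q < 1 -> 0 < e -> exists n, q ^+ n < e.
Proof.
move=> /andP[q0 q1] e0; have [->|qn0] := eqVneq q 0; first by exists 1%N.
have qp : 0 < q by rewrite lt_neqAle eq_sym qn0.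
have d0 : 0 < q^-1 - 1 by rewrite subr_gt0 invf_gt1.
have [n hn] := mul_natr_unbounded (e^-1) d0.
exists n; rewrite -(invrK (q ^+ n)) -(invrK e) ltf_pV2 ?posrE ?invr_gt0 ?exprn_gt0 //.
rewrite -exprVn; apply: (lt_le_trans hn).
have := bernoulli_le n (ltW d0); rewrite [1 + (_ - 1)]addrC subrK.
by apply: le_trans; rewrite lerDr.
Qed.

Lemma le_of_exp_le_linear x y c : 0 <= x -> 0 <= y -> 0 <= c ->
  (forall n : nat, x ^+ (2 ^ n) <= (c * (2 ^ n)%:R + 1) * y ^+ (2 ^ n)) ->
  x <= y.
Proof.
move=> x0 y0 c0 H; rewrite leNgt; apply/negP => yx.
have xp : 0 < x by apply: le_lt_trans yx.
have [yz|yn0] := eqVneq y 0.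
  have := H 0%N; rewrite yz !expr1 mulr0 leNgt.
  by rewrite xp.
have yp : 0 < y by rewrite lt_neqAle eq_sym yn0.
pose t := x / y; pose e := t - 1.
have e0 : 0 < e by rewrite subr_gt0 ltr_pdivlMr // mul1r.
have Ht n : t ^+ (2 ^ n) <= c * (2 ^ n)%:R + 1.
  by rewrite expr_div_n ler_pdivrMr ?exprn_gt0.
(* At exponent [2 ^ n.+1], Bernoulli applied to the half exponent and then squared gives a lower
   bound quadratic in [m = 2 ^ n]. The upper bound is at most [(2 * c + 1) * m], and this [n] makes
   the two incompatible. *)
have [n hn] := mul_natr_unbounded (2 * c + 1) (exprn_gt0 2 e0).
have mge : n%:R <= (2 ^ n)%:R :> R by rewrite ler_nat ltnW // ltn_expl.
set m : R := (2 ^ n)%:R in mge.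
have m1 : 1 <= m by rewrite ler1n expn_gt0.
have := Ht n.+1; rewrite expnS mulnC exprM natrM -/m.
have b : e * m <= t ^+ (2 ^ n).
  have := bernoulli_le (2 ^ n) (ltW e0); rewrite /e [1 + (_ - 1)]addrC subrK.
  by apply: le_trans; rewrite lerDr.
have b2 : (e * m) ^+ 2 <= (t ^+ (2 ^ n)) ^+ 2.
  by rewrite lerXn2r ?nnegrE // ?mulr_ge0 ?(ltW e0) ?exprn_ge0 ?divr_ge0 //.
have b3 : e ^+ 2 * n%:R <= e ^+ 2 * m by rewrite ler_wpM2l // sqr_ge0.
have b4 : (2 * c + 1) * m < (e * m) ^+ 2.
  rewrite exprMn expr2 mulrA ltr_pM2r; last by lra.
  by rewrite -expr2; apply: lt_le_trans b3.
move: b2 b4; set X := (e * m) ^+ 2; set Y := (t ^+ _) ^+ 2; nra.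
Qed.

End RealPowers.

(** * Norm, involution and limits in a C*-algebra *)

Section NormBasics.
Context {R : realType} {A : cstarAlgType R}.
Implicit Types (a b h : A) (k : R[i]) (r : R).

Lemma star0 : star (0 : A) = 0.
Proof. by rewrite -[X in star X](scale0r (0 : A)) starZ rmorph0 scale0r. Qed.

Lemma starN a : star (- a) = - star a.
Proof. by rewrite -scaleN1r starZ rmorphN rmorph1 scaleN1r. Qed.

Lemma starB a b : star (a - b) = star a - star b.
Proof. by rewrite starD starN. Qed.

Lemma star1 : star (1 : A) = 1.
Proof. by rewrite -[LHS]mulr1 -[X in star 1 * X]starK -starM mulr1 starK. Qed.

Lemma star_sum I (s : seq I) (P : pred I) (F : I -> A) :
  star (\sum_(i <- s | P i) F i) = \sum_(i <- s | P i) star (F i).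
Proof.
elim: s => [|i s IH]; first by rewrite !big_nil star0.
by rewrite !big_cons; case: (P i); rewrite ?starD IH.
Qed.

Lemma starX a n : star (a ^+ n) = star a ^+ n.
Proof. by elim: n => [|n IH]; rewrite ?expr0 ?star1 // exprS starM IH -exprSr. Qed.

Lemma normc_real r : normc r%:C = `|r|.
Proof. by rewrite /normc /= expr0n addr0 sqrtr_sqr. Qed.

Lemma normc_i : normc ('i : R[i]) = 1.
Proof. by rewrite /normc /= expr0n expr1n add0r sqrtr1. Qed.

Lemma cnorm0 : cnorm (0 : A) = 0.
Proof. by rewrite -(scale0r (0 : A)) cnormZ normc0 mul0r. Qed.

Lemma cnormN a : cnorm (- a) = cnorm a.
Proof.
rewrite -scaleN1r cnormZ (_ : (-1 : R[i]) = (-1)%:C); last by rewrite rmorphN1.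
by rewrite normc_real normrN1 mul1r.
Qed.

Lemma cnorm_ge0 a : 0 <= cnorm a.
Proof. by have := cnormD a (- a); rewrite subrr cnorm0 cnormN; lra. Qed.

Lemma cnormB a b : cnorm (a - b) <= cnorm a + cnorm b.
Proof. by rewrite -(cnormN b) cnormD. Qed.

Lemma cnorm_distC a b : cnorm (a - b) = cnorm (b - a).
Proof. by rewrite -cnormN opprB. Qed.

Lemma cnorm_sum I (s : seq I) (F : I -> A) :
  cnorm (\sum_(i <- s) F i) <= \sum_(i <- s) cnorm (F i).
Proof.
elim: s => [|i s IH]; first by rewrite !big_nil cnorm0.
by rewrite !big_cons; apply: (le_trans (cnormD _ _)); rewrite lerD2l.
Qed.

Lemma cnorm_starE a : cnorm (star a) = cnorm a.
Proof.
have le b : cnorm b <= cnorm (star b).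
  have [->|n0] := eqVneq (cnorm b) 0; first exact: cnorm_ge0.
  have p : 0 < cnorm b by rewrite lt_neqAle eq_sym n0 cnorm_ge0.
  have := cnormM (star b) b; rewrite cnorm_star expr2.
  by rewrite ler_pM2r.
by apply/eqP; rewrite eq_le le -{2}(starK a) le.
Qed.

Lemma cnorm_isometry a : star a * a = 1 -> cnorm a = 1.
Proof.
(* The C*-identity makes the norm of 1 idempotent; it is not 0 because [1 != 0] in [A]. *)
have n1 : cnorm (1 : A) = 1.
  have := cnorm_star (1 : A); rewrite star1 mulr1 expr2 => e.
  have : cnorm (1 : A) != 0 by apply: contra_neq (oner_neq0 A); exact: cnorm_eq0.
  by move=> /mulfI; apply; rewrite -e mulr1.
move=> /(congr1 cnorm); rewrite cnorm_star n1 => e.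
apply/eqP; rewrite -(@eqrXn2 _ 2) ?cnorm_ge0 // e expr1n //.
Qed.

Lemma cnorm1 : cnorm (1 : A) = 1.
Proof. by apply: cnorm_isometry; rewrite star1 mulr1. Qed.

Lemma cnorm_isometry_mul s a : star s * s = 1 -> cnorm (s * a) = cnorm a.
Proof.
move=> e; apply/eqP; rewrite -(@eqrXn2 _ 2) ?cnorm_ge0 //.
by rewrite -!cnorm_star starM mulrA -(mulrA (star a)) e mulr1.
Qed.

Lemma cnorm_small_eq0 a : (forall e : R, 0 < e -> cnorm a < e) -> a = 0.
Proof.
move=> H; apply: cnorm_eq0; apply/eqP; rewrite eq_le cnorm_ge0 andbT.
by apply/ler_addgt0Pl => e e0; rewrite addr0 ltW // H.
Qed.

(** Each doubling of the exponent is one use of the C*-identity, whence the restriction to powers of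
    two. *)
Lemma cnorm_exp_sa h n : star h = h -> cnorm (h ^+ (2 ^ n)) = cnorm h ^+ (2 ^ n).
Proof.
move=> sh; elim: n => [|n IH]; first by rewrite !expr1.
rewrite expnS mulnC !exprM -IH -cnorm_star; congr cnorm.
by rewrite starX sh expr2.
Qed.

Definition converges (u : nat -> A) (l : A) : Prop :=
  forall e : R, 0 < e -> exists n : nat, forall p : nat,
    (n <= p)%N -> cnorm (u p - l) < e.

Lemma converges_cst a : converges (fun=> a) a.
Proof. by move=> e e0; exists 0%N => p _; rewrite subrr cnorm0. Qed.

Lemma converges_star u l : converges u l -> converges (fun n => star (u n)) (star l).
Proof.
by move=> H e /H[n Hn]; exists n => p /Hn; rewrite -starB cnorm_starE.
Qed.

Lemma convergesD u v l m : converges u l -> converges v m ->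
  converges (fun n => u n + v n) (l + m).
Proof.
move=> Hu Hv e e0; have e2 : 0 < e / 2 by rewrite divr_gt0.
have [n Hn] := Hu _ e2; have [n' Hn'] := Hv _ e2.
exists (maxn n n') => p; rewrite geq_max => /andP[/Hn h1 /Hn' h2].
rewrite opprD addrACA; apply: (le_lt_trans (cnormD _ _)); lra.
Qed.

Lemma convergesZ k u l : converges u l -> converges (fun n => k *: u n) (k *: l).
Proof.
move=> Hu e e0; have nk : 0 <= normc k by case: k => x y; rewrite /normc sqrtr_ge0.
have e2 : 0 < e / (normc k + 1) by rewrite divr_gt0 // ltr_wpDl.
have [n Hn] := Hu _ e2; exists n => p /Hn; rewrite -scalerBr cnormZ.
rewrite ltr_pdivlMr; last by rewrite ltr_wpDl.
by apply: le_lt_trans; rewrite mulrC ler_wpM2l ?cnorm_ge0 // lerDl.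
Qed.

Lemma convergesM u v l m : converges u l -> converges v m ->
  converges (fun n => u n * v n) (l * m).
Proof.
(* The summand [e] in the denominator forces [d < 1], so the quadratic error [d * d] is absorbed by
   [d]. *)
move=> Hu Hv e e0; pose d := e / (1 + cnorm l + cnorm m + e).
have lm : 0 <= cnorm l /\ 0 <= cnorm m by rewrite !cnorm_ge0.
have d0 : 0 < d by rewrite divr_gt0 //; lra.
have d1 : d < 1 by rewrite ltr_pdivrMr; lra.
have de : d * (1 + cnorm l + cnorm m) < e.
  rewrite /d mulrAC ltr_pdivrMr; last by lra.
  by rewrite ltr_pM2l //; lra.
have [n Hn] := Hu _ d0; have [n' Hn'] := Hv _ d0.
exists (maxn n n') => p; rewrite geq_max => /andP[/Hn h1 /Hn' h2].
have -> : u p * v p - l * m = (u p - l) * (v p - m) + (u p - l) * m + l * (v p - m).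
  by rewrite -mulrDr subrK mulrBl mulrBr addrA subrK.
apply: (le_lt_trans (cnormD _ _)).
apply: (@le_lt_trans _ _ (d * d + d * cnorm m + cnorm l * d)); last by nra.
apply: lerD; last by apply: (le_trans (cnormM _ _)); rewrite ler_wpM2l ?(ltW h2); lra.
apply: (le_trans (cnormD _ _)); apply: lerD.
  by apply: (le_trans (cnormM _ _)); apply: ler_pM => //; rewrite ?cnorm_ge0 ?ltW.
by apply: (le_trans (cnormM _ _)); rewrite ler_wpM2r ?(ltW h1) ?cnorm_ge0.
Qed.

Lemma converges_shift u l : converges u l -> converges (fun n => u n.+1) l.
Proof. by move=> H e /H[n Hn]; exists n => p np; apply: Hn; rewrite leqW. Qed.

Lemma converges_unique u l m : converges u l -> converges u m -> l = m.
Proof.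
move=> Hu Hv; apply/eqP; rewrite -subr_eq0; apply/eqP.
apply: cnorm_small_eq0 => e e0; have e2 : 0 < e / 2 by rewrite divr_gt0.
have [n Hn] := Hu _ e2; have [n' Hn'] := Hv _ e2.
have h1 := Hn _ (leq_maxl n n'); have h2 := Hn' _ (leq_maxr n n').
rewrite -(subrK (u (maxn n n')) l) -addrA; apply: (le_lt_trans (cnormD _ _)).
by rewrite cnorm_distC; lra.
Qed.

End NormBasics.

(** * Square roots by iteration, and decomposition into unitaries *)

Section UnitaryDilation.
Context {R : realType} {A : cstarAlgType R}.
Implicit Types (a b c h x y u : A) (r : R).

Lemma normc_half : normc (2^-1 : R[i]) = 2^-1.
Proof.
rewrite (_ : (2^-1 : R[i]) = (2^-1)%:C); last by rewrite fmorphV rmorph_nat.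
by rewrite normc_real ger0_norm.
Qed.

Lemma half_double a : 2^-1 *: (a + a) = a.
Proof.
have -> : a + a = (2 : R[i]) *: a by rewrite scaler_nat mulr2n.
by rewrite scalerA mulVf ?scale1r // pnatr_eq0.
Qed.

(* With [y = 1 - b] the equation [b ^+ 2 = 1 - c] is the fixed-point equation
   [y = (c + y ^+ 2) / 2], whose iteration from [0] stays in the ball of radius
   [cnorm c], where it is a contraction. *)
Lemma sqrt_one_minus c : star c = c -> cnorm c < 1 ->
  exists b, [/\ star b = b, b * b = 1 - c
              & forall x, x * c = c * x -> x * b = b * x].
Proof.
move=> sc; set q := cnorm c => q1; have q0 : 0 <= q by rewrite cnorm_ge0.
pose y n := iter n (fun y => 2^-1 *: (c + y * y)) 0.
have yS n : y n.+1 = 2^-1 *: (c + y n * y n) by [].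
have yle n : cnorm (y n) <= q.
  elim: n => [|n IH]; first by rewrite cnorm0.
  rewrite yS cnormZ normc_half.
  have h1 := cnormD c (y n * y n); have h2 := cnormM (y n) (y n).
  have h3 : cnorm (y n) * cnorm (y n) <= q * 1.
    by apply: ler_pM; rewrite ?cnorm_ge0 //; apply: (le_trans IH (ltW q1)).
  by rewrite -/q in h1; lra.
have dy n : cnorm (y n.+1 - y n) <= q ^+ n.
  elim: n => [|n IH].
    rewrite expr0 subr0 yS mulr0 addr0 cnormZ normc_half -/q; lra.
  rewrite yS [y n.+1 in X in _ - X]yS -scalerBr cnormZ normc_half.
  (* A difference of squares split without commutativity: two terms of size [q * q ^+ n], which the
     factor 1/2 averages to [q ^+ n.+1]. *)
  have -> : c + y n.+1 * y n.+1 - (c + y n * y n) =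
      y n.+1 * (y n.+1 - y n) + (y n.+1 - y n) * y n.
    by rewrite mulrBr mulrBl addrA subrK opprD addrACA subrr add0r.
  have h1 : cnorm (y n.+1 * (y n.+1 - y n)) <= q * q ^+ n.
    by apply: (le_trans (cnormM _ _)); apply: ler_pM; rewrite ?cnorm_ge0.
  have h2 : cnorm ((y n.+1 - y n) * y n) <= q * q ^+ n.
    by apply: (le_trans (cnormM _ _)); rewrite mulrC; apply: ler_pM; rewrite ?cnorm_ge0.
  have := cnormD (y n.+1 * (y n.+1 - y n)) ((y n.+1 - y n) * y n).
  rewrite exprS; lra.
(* The geometric tail, multiplied by [1 - q] to avoid division; it makes [y] a Cauchy sequence. *)
have tel n k : (1 - q) * cnorm (y (n + k)%N - y n) <= q ^+ n - q ^+ (n + k).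
  elim: k => [|k IH]; first by rewrite addn0 !subrr cnorm0 mulr0.
  rewrite addnS exprS; have := dy (n + k)%N.
  have := cnormD (y (n + k).+1 - y (n + k)%N) (y (n + k)%N - y n).
  rewrite addrA subrK; set t := q ^+ (n + k) in IH *; nra.
have [|l Hl] := @cnorm_complete R A y.
  move=> e e0; have e1 : 0 < e * (1 - q) / 2 by rewrite divr_gt0 // mulr_gt0 // subr_gt0.
  have [|n Hn] := @geometric_small R q _ _ e1; first by rewrite q0.
  have near p : (n <= p)%N -> cnorm (y p - y n) < e / 2.
    move=> /subnKC <-; have := tel n (p - n)%N.
    have : 0 <= q ^+ (n + (p - n)) by rewrite exprn_ge0.
    by move=> ? ?; rewrite -(ltr_pM2l (_ : 0 < 1 - q)) ?subr_gt0 //; lra.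
  exists n => p p' /near h1 /near h2.
  rewrite -(subrK (y n) (y p)) -addrA; apply: (le_lt_trans (cnormD _ _)).
  rewrite (cnorm_distC (y n)); lra.
have {Hl} Hl : converges y l by [].
have fix_l : l = 2^-1 *: (c + l * l).
  apply: (converges_unique (converges_shift Hl)).
  by apply: convergesZ; apply: convergesD; [exact: converges_cst|exact: convergesM].
have sl : star l = l.
  apply: (@converges_unique _ _ (fun n => star (y n))); first exact: converges_star.
  suff E n : star (y n) = y n by move=> e /Hl[n Hn]; exists n => p /Hn; rewrite E.
  elim: n => [|n IH]; first by rewrite star0.
  by rewrite yS starZ starD starM IH sc fmorphV rmorph_nat.
exists (1 - l); split.
- by rewrite starB star1 sl.
- have E : l + l = c + l * l.
    by rewrite {1 2}fix_l -scalerDr half_double.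
  have -> : c = l + l - l * l by rewrite E addrK.
  by rewrite mulrBr mulr1 mulrBl mul1r -addrA -opprD addrA.
- move=> x xc; rewrite mulrBr mulrBl mulr1 mul1r; congr (_ - _).
  apply: (@converges_unique _ _ (fun n => x * y n)).
    by apply: convergesM => //; exact: converges_cst.
  suff E n : x * y n = y n * x.
    by move=> e /(convergesM Hl (converges_cst x))[n Hn]; exists n => p /Hn; rewrite E.
  elim: n => [|n IH]; first by rewrite mulr0 mul0r.
  by rewrite yS -scalerAr -scalerAl mulrDr mulrDl xc mulrA IH -mulrA IH mulrA.
Qed.

(** The unitary is [h + 'i *: b] with [b] a square root of [1 - h * h]. It is unitary because [b]
    commutes with whatever commutes with [h * h], in particular with [h]. *)
Lemma sa_half_sum_unitary h : star h = h -> cnorm h < 1 ->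
  exists u, [/\ star u * u = 1, u * star u = 1 & h = 2^-1 *: (u + star u)].
Proof.
move=> sh h1.
have [||b [sb bb cb]] := @sqrt_one_minus (h * h).
- by rewrite starM sh.
- rewrite -{1}sh cnorm_star expr2; have := cnorm_ge0 h; nra.
have hb : h * b = b * h by apply: cb; rewrite mulrA.
have hb1 : h * h + b * b = 1 by rewrite bb addrC subrK.
have ii : 'i * 'i = -1 :> R[i] by rewrite -expr2 sqr_i.
have prod (v : R[i]) : v * v = -1 -> (h + v *: b) * (h - v *: b) = 1.
  move=> vv; rewrite mulrDl !mulrBr -!scalerAl -!scalerAr scalerA vv -hb.
  by rewrite scaleN1r opprK addrA subrK.
exists (h + 'i *: b).
have -> : star (h + 'i *: b) = h - 'i *: b.
  by rewrite starD starZ sh sb -scaleNr; congr (_ + _ *: _); apply/eqP;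
    rewrite eq_complex /= oppr0 !eqxx.
split; first 2 last.
- by rewrite addrACA subrr addr0 half_double.
- by have := prod (- 'i); rewrite scaleNr opprK mulrNN; apply.
- exact: prod.
Qed.

Lemma sa_scaled_half_sum_unitary h r : star h = h -> cnorm h < r ->
  exists u, [/\ star u * u = 1, u * star u = 1 & h = (r / 2)%:C *: (u + star u)].
Proof.
move=> sh hr; have r0 : 0 < r by apply: le_lt_trans hr; exact: cnorm_ge0.
have [||u [u1 u2 e]] := @sa_half_sum_unitary ((r^-1)%:C *: h).
- rewrite starZ sh; congr (_ *: _).
  by apply/eqP; rewrite eq_complex /= oppr0 !eqxx.
- by rewrite cnormZ normc_real gtr0_norm ?invr_gt0 // mulrC ltr_pdivrMr // mul1r.
exists u; split=> //.
have -> : h = r%:C *: ((r^-1)%:C *: h).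
  by rewrite scalerA -rmorphM divff ?scale1r // gt_eqF.
by rewrite e scalerA rmorphM fmorphV rmorph_nat.
Qed.

(** The real and imaginary parts of [a] have norm below [r], and each is a multiple of a unitary
    plus its adjoint. This turns facts about unitaries into norm estimates for arbitrary
    elements. *)
Lemma unitary_decomposition a r : cnorm a < r ->
  exists u v, [/\ star u * u = 1, star v * v = 1, u * star u = 1, v * star v = 1 &
    a = (r / 2)%:C *: (u + star u) + ('i * (r / 2)%:C) *: (v + star v)].
Proof.
move=> ar.
have sa_norm (b : A) (k : R[i]) : normc k = 2^-1 -> cnorm b <= cnorm a + cnorm a ->
    cnorm (k *: b) < r.
  by move=> nk hb; rewrite cnormZ nk; lra.
have nk : normc (- 'i / 2 : R[i]) = 2^-1.
  by rewrite normcM normcN normc_i mul1r normc_half.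
have [||u [u1 u2 eu]] := @sa_scaled_half_sum_unitary (2^-1 *: (a + star a)) r.
- by rewrite starZ starD starK addrC fmorphV rmorph_nat.
- apply: sa_norm; first exact: normc_half.
  by apply: (le_trans (cnormD _ _)); rewrite cnorm_starE.
have [||v [v1 v2 ev]] := @sa_scaled_half_sum_unitary ((- 'i / 2) *: (a - star a)) r.
- rewrite starZ starB starK -opprB scalerN -scaleNr; congr (_ *: _).
  rewrite rmorphM rmorphN fmorphV rmorph_nat -mulNr. congr (_ * _).
  by apply/eqP; rewrite eq_complex /= ?oppr0 ?opprK !eqxx.
- apply: sa_norm => //.
  by apply: (le_trans (cnormB _ _)); rewrite cnorm_starE.
exists u, v; split=> //.
rewrite -eu -scalerA -ev scalerA mulrA mulrN -expr2 sqr_i opprK mul1r -scalerDr.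
by rewrite addrACA subrr addr0 half_double.
Qed.

End UnitaryDilation.

(** A unital morphism sends unitaries to unitaries, of norm 1, so a self-adjoint [h] written as a
    multiple of [u + star u] with [u] unitary is not expanded. The general case follows from the
    C*-identity. *)
Lemma star_morphism_contractive (R : realType) (A B : cstarAlgType R)
  (phi : {lrmorphism A -> B}) : star_morphism phi ->
  forall a, cnorm (phi a) <= cnorm a.
Proof.
move=> sphi; have sa h : star h = h -> cnorm (phi h) <= cnorm h.
  move=> sh; apply/ler_addgt0Pl => e e0; 
  have [|u [u1 u2 eh]] := @sa_scaled_half_sum_unitary _ _ h (e + cnorm h) sh.
    by rewrite ltrDr.
  have n1 : cnorm (phi u) = 1.
    by apply: cnorm_isometry; rewrite -sphi -rmorphM u1 rmorph1.
  rewrite [in phi h]eh linearZ /= cnormZ normc_real.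
  rewrite (rmorphD phi) /= sphi ger0_norm; last first.
    by rewrite divr_ge0 // addr_ge0 ?cnorm_ge0 // ltW.
  have := cnormD (phi u) (star (phi u)); rewrite cnorm_starE n1.
  have := cnorm_ge0 h; nra.
move=> a; rewrite -(@ler_pXn2r _ 2) ?nnegrE ?cnorm_ge0 //.
rewrite -!cnorm_star -sphi -rmorphM sa //.
by rewrite starM starK.
Qed.

(** * Words in the Cuntz generators, their span, and the matrix subalgebras *)

Section Words.
Context {R : realType} {A : cstarAlgType R} {N : nat} (S : 'I_N -> A).
Hypothesis hS : cuntz_family S.
Implicit Types (a b X Y : A) (i j : 'I_N) (u v w : seq 'I_N).

Lemma cuntz_isometry i : star (S i) * S i = 1.
Proof. by rewrite hS.1 eqxx. Qed.

Lemma cuntz_orthogonal i j : i != j -> star (S i) * S j = 0.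
Proof. by rewrite hS.1 => /negbTE ->. Qed.

Definition word_op w : A := \prod_(i <- w) S i.

Lemma word_op_nil : word_op [::] = 1.
Proof. exact: big_nil. Qed.

Lemma word_op_cons i w : word_op (i :: w) = S i * word_op w.
Proof. exact: big_cons. Qed.

Lemma word_op_cat u v : word_op (u ++ v) = word_op u * word_op v.
Proof. exact: big_cat. Qed.

Lemma word_op_isometry w : star (word_op w) * word_op w = 1.
Proof.
elim: w => [|i w IH]; first by rewrite word_op_nil star1 mulr1.
by rewrite word_op_cons starM mulrA -(mulrA (star _)) cuntz_isometry mulr1.
Qed.

(** Equal leading letters cancel and different ones give 0, until one word is exhausted. The length
    bounds let [word_spanM] add degrees. *)
Lemma star_word_mul u v : exists w,
  [\/ star (word_op u) * word_op v = 0,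
      star (word_op u) * word_op v = word_op w /\ (size w <= size v)%N
    | star (word_op u) * word_op v = star (word_op w) /\ (size w <= size u)%N].
Proof.
elim: u v => [|i u IH] v.
  by exists v; apply: Or32; rewrite word_op_nil star1 mul1r.
case: v => [|j v].
  by exists (i :: u); apply: Or33; rewrite word_op_nil mulr1.
rewrite !word_op_cons starM mulrA -(mulrA (star _)).
have [<-|ij] := eqVneq i j; last first.
  by exists [::]; apply: Or31; rewrite cuntz_orthogonal // mulr0 mul0r.
have [w [e|[e l]|[e l]]] := IH v; exists w; rewrite cuntz_isometry mulr1 e.
- exact: Or31.
- by apply: Or32; split=> //; apply: leq_trans l _.
- by apply: Or33; split=> //; apply: leq_trans l _.
Qed.

(** The linear span is given by closure rules, so that a linear identity is proved by induction and
    only has to be computed on one product of words. *)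
Inductive word_span (k : nat) : A -> Prop :=
| word_span0 : word_span k 0
| word_spanD a b : word_span k a -> word_span k b -> word_span k (a + b)
| word_spanZ c a : word_span k a -> word_span k (c *: a)
| word_span_word u v : (size u <= k)%N -> (size v <= k)%N ->
    word_span k (word_op u * star (word_op v)).

Lemma word_span_le k l a : (k <= l)%N -> word_span k a -> word_span l a.
Proof.
move=> kl; elim=> [|b c _ + _|c b _|u v uk vk].
- exact: word_span0.
- exact: word_spanD.
- exact: word_spanZ.
- by apply: word_span_word; apply: leq_trans kl.
Qed.

Lemma word_span_star k a : word_span k a -> word_span k (star a).
Proof.
elim=> [|b c _ + _|c b _|u v uk vk].
- by rewrite star0; exact: word_span0.
- by rewrite starD; exact: word_spanD.
- by rewrite starZ; exact: word_spanZ.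
- by rewrite starM starK; exact: word_span_word.
Qed.

Lemma word_spanM k l a b :
  word_span k a -> word_span l b -> word_span (k + l) (a * b).
Proof.
move=> + hb; elim=> [|a1 a2 _ h1 _ h2|c a1 _ h1|u v uk vk].
- by rewrite mul0r; exact: word_span0.
- by rewrite mulrDl; exact: word_spanD.
- by rewrite -scalerAl; exact: word_spanZ.
elim: hb => [|b1 b2 _ h1 _ h2|c b1 _ h1|u' v' uk' vk'].
- by rewrite mulr0; exact: word_span0.
- by rewrite mulrDr; exact: word_spanD.
- by rewrite -scalerAr; exact: word_spanZ.
rewrite mulrA -(mulrA (word_op u)).
have [w [->|[-> l1]|[-> l1]]] := star_word_mul v u'.
- by rewrite mulr0 mul0r; exact: word_span0.
- rewrite -word_op_cat; apply: word_span_word.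
    by rewrite size_cat leq_add // (leq_trans l1).
  by rewrite (leq_trans vk') // leq_addl.
- rewrite -mulrA -starM -word_op_cat; apply: word_span_word.
    by rewrite (leq_trans uk) // leq_addr.
  by rewrite size_cat addnC leq_add // (leq_trans l1).
Qed.

Lemma word_span_gen i : word_span 1 (S i).
Proof.
have := @word_span_word 1 [:: i] [::] isT isT.
by rewrite word_op_cons word_op_nil star1 !mulr1.
Qed.

Lemma word_span1 k : word_span k 1.
Proof.
have := @word_span_word k [::] [::] isT isT.
by rewrite word_op_nil star1 mulr1.
Qed.

Lemma word_spanX k a n : word_span k a -> word_span (k * n) (a ^+ n).
Proof.
move=> ha; elim: n => [|n IH]; first by rewrite expr0; exact: word_span1.
by rewrite exprS mulnS; apply: word_spanM.
Qed.

(** The elements approximable by polynomials in the generators form a closed star-subalgebra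
    containing the generators. *)
Lemma word_span_dense : generates (range S) ->
  forall x e, 0 < e -> exists k a, word_span k a /\ cnorm (x - a) < e.
Proof.
move=> gen.
pose P := [set x : A | forall e, 0 < e -> exists k a, word_span k a /\ cnorm (x - a) < e].
suff PT : P = setT by move=> x; have : P x by rewrite PT.
apply: gen.
- split=> [x y hx hy e e0|c x hx e e0|x y hx hy e e0|x hx e e0].
  + have e2 : 0 < e / 2 by rewrite divr_gt0.
    have [k [a [ha xa]]] := hx _ e2; have [l [b [hb yb]]] := hy _ e2.
    exists (maxn k l), (a + b); split.
      by apply: word_spanD; [apply: word_span_le ha|apply: word_span_le hb];
        rewrite ?leq_maxl ?leq_maxr.
    rewrite opprD addrACA; apply: (le_lt_trans (cnormD _ _)); lra.
  + have nk : 0 <= normc c by case: c => s t; rewrite /normc sqrtr_ge0.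
    have e2 : 0 < e / (normc c + 1) by rewrite divr_gt0 // ltr_wpDl.
    have [k [a [ha xa]]] := hx _ e2; exists k, (c *: a); split; first exact: word_spanZ.
    rewrite -scalerBr cnormZ; move: xa.
    rewrite ltr_pdivlMr; last by rewrite ltr_wpDl.
    by apply: le_lt_trans; rewrite mulrC ler_wpM2l ?cnorm_ge0 // lerDl.
  + have xy : 0 <= cnorm x /\ 0 <= cnorm y by rewrite !cnorm_ge0.
    pose d := e / (1 + cnorm x + cnorm y + e).
    have d0 : 0 < d by rewrite divr_gt0 //; lra.
    have d1 : d < 1 by rewrite ltr_pdivrMr; lra.
    have de : d * (1 + cnorm x + cnorm y) < e.
      rewrite /d mulrAC ltr_pdivrMr; last by lra.
      by rewrite ltr_pM2l //; lra.
    have [k [a [ha xa]]] := hx _ d0; have [l [b [hb yb]]] := hy _ d0.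
    exists (k + l)%N, (a * b); split; first exact: word_spanM.
    have -> : x * y - a * b = x * (y - b) + (x - a) * b.
      by rewrite mulrBr mulrBl addrA subrK.
    have nb : cnorm b <= cnorm y + d.
      rewrite -(subKr y b); apply: (le_trans (cnormB _ _)); lra.
    have h1 := cnormM x (y - b); have h2 := cnormM (x - a) b.
    apply: (le_lt_trans (cnormD _ _)).
    have h3 : cnorm x * cnorm (y - b) <= cnorm x * d by rewrite ler_wpM2l ?cnorm_ge0 ?ltW.
    have h4 : cnorm (x - a) * cnorm b <= d * (cnorm y + d).
      by apply: ler_pM; rewrite ?cnorm_ge0 // ltW.
    nra.
  + have [k [a [ha xa]]] := hx _ e0; exists k, (star a); split.
      exact: word_span_star.
    by rewrite -starB cnorm_starE.
- move=> u l hu ul e e0; have e2 : 0 < e / 2 by rewrite divr_gt0.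
  have [n /(_ n (leqnn n)) hn] := ul _ e2; have [k [a [ha una]]] := hu n _ e2.
  exists k, a; split=> //.
  rewrite -(subrK (u n) l) -addrA; apply: (le_lt_trans (cnormD _ _)).
  by rewrite cnorm_distC; lra.
- move=> _ [i _ <-] e e0; exists 1%N, (S i); split; first exact: word_span_gen.
  by rewrite subrr cnorm0.
Qed.

Lemma cuntz_expand X :
  X = \sum_i \sum_j S i * (star (S i) * X * S j) * star (S j).
Proof.
transitivity ((\sum_i S i * star (S i)) * X * (\sum_j S j * star (S j))).
  by rewrite hS.2 mul1r mulr1.
rewrite mulr_suml mulr_suml; apply: eq_bigr => i _.
by rewrite mulr_sumr; apply: eq_bigr => j _; rewrite !mulrA.
Qed.

(* The span of the [word_op u * star (word_op v)] with [size u = size v = k],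
   a copy of the matrix algebra of size [N ^ k], characterized by its matrix
   entries. *)
Fixpoint core (k : nat) X : Prop :=
  if k is k'.+1 then forall i j, core k' (star (S i) * X * S j)
  else exists c : R[i], X = c *: 1.

Lemma coreD k X Y : core k X -> core k Y -> core k (X + Y).
Proof.
elim: k X Y => [|k IH] X Y.
  by move=> [c ->] [d ->]; exists (c + d); rewrite scalerDl.
by move=> hX hY i j; rewrite mulrDr mulrDl; exact: IH.
Qed.

Lemma coreZ k c X : core k X -> core k (c *: X).
Proof.
elim: k X => [|k IH] X; first by move=> [d ->]; exists (c * d); rewrite scalerA.
by move=> hX i j; rewrite -scalerAr -scalerAl; exact: IH.
Qed.

Lemma core_scalar k c : core k (c *: 1).
Proof.
elim: k c => [|k IH] c; first by exists c.
move=> i j; rewrite -scalerAr mulr1 -scalerAl hS.1.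
by case: (i == j); rewrite ?scaler0 // -(scale0r 1); exact: IH.
Qed.

Lemma core0 k : core k 0.
Proof. by rewrite -(scale0r 1); exact: core_scalar. Qed.

Lemma core_sum k I (s : seq I) (F : I -> A) :
  (forall x, core k (F x)) -> core k (\sum_(i <- s) F i).
Proof.
move=> hF; elim: s => [|x s IH]; first by rewrite big_nil; exact: core0.
by rewrite big_cons; exact: coreD.
Qed.

Lemma coreM k X Y : core k X -> core k Y -> core k (X * Y).
Proof.
elim: k X Y => [|k IH] X Y.
  by move=> [c ->] [d ->]; exists (c * d); rewrite -scalerAl mul1r scalerA.
move=> hX hY i j.
(* Inserting the unit as a sum of range projections turns the product into matrix multiplication of
   entries. *)
have -> : X * Y = X * (\sum_l S l * star (S l)) * Y by rewrite hS.2 mulr1.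
rewrite mulr_sumr mulr_suml mulr_sumr mulr_suml; apply: core_sum => l.
have -> : star (S i) * (X * (S l * star (S l)) * Y) * S j =
  (star (S i) * X * S l) * (star (S l) * Y * S j) by rewrite !mulrA.
exact: IH.
Qed.

Lemma core_star k X : core k X -> core k (star X).
Proof.
elim: k X => [|k IH] X; first by move=> [c ->]; exists (c^*); rewrite starZ star1.
move=> hX i j; rewrite -(starK (S j)) -(mulrA (star (S i))) -starM -starM.
exact: IH.
Qed.

Lemma coreX k X n : core k X -> core k (X ^+ n).
Proof.
move=> hX; elim: n => [|n IH]; last by rewrite exprS; exact: coreM.
by rewrite expr0 -(scale1r 1); exact: core_scalar.
Qed.

(** Words shorter than [k] are allowed because the scalars lie in the core of every level. *)
Lemma core_word k u v : size u = size v -> (size u <= k)%N ->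
  core k (word_op u * star (word_op v)).
Proof.
elim: k u v => [|k IH] [|i u] [|j v] //.
- by rewrite word_op_nil star1 mulr1 -(scale1r 1) => _ _; exact: core_scalar.
- by rewrite word_op_nil star1 mulr1 -(scale1r 1) => _ _; exact: core_scalar.
move=> [uv] uk a b; rewrite !word_op_cons starM.
have -> : star (S a) * (S i * word_op u * (star (word_op v) * star (S j))) * S b =
  (star (S a) * S i) * (word_op u * star (word_op v)) * (star (S j) * S b).
  by rewrite !mulrA.
rewrite !hS.1; case: (a == i); last by rewrite !mul0r; exact: core0.
case: (j == b); last by rewrite !mulr0; exact: core0.
by rewrite mul1r mulr1; exact: IH.
Qed.

End Words.

(** * Extracting homogeneous components by isometries *)

Section Compression.
Context {R : realType} {A : cstarAlgType R} {N : nat} (S : 'I_N -> A).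
Hypothesis hS : cuntz_family S.
Variables (i0 i1 : 'I_N) (r : nat).
Hypothesis i01 : i0 != i1.
Implicit Types (a b : A) (i j : 'I_N) (u v w : seq 'I_N) (d k l : nat).
Local Notation word_op := (word_op S).

(* The isometry [\sum_(|w| = k) S_w (S_i0 ^+ r * S_i1) S_w^*] of Cuntz. *)
Fixpoint spread k : A :=
  if k is k'.+1 then \sum_i S i * spread k' * star (S i) else S i0 ^+ r * S i1.

Lemma star_mul_spread k i : star (S i) * spread k.+1 = spread k * star (S i).
Proof.
rewrite /= mulr_sumr (bigD1 i) //= big1 ?addr0 => [|j ji].
  by rewrite !mulrA cuntz_isometry // mul1r.
by rewrite !mulrA cuntz_orthogonal ?mul0r // eq_sym.
Qed.

Lemma star_word_spread k w : (size w <= k)%N ->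
  star (word_op w) * spread k = spread (k - size w) * star (word_op w).
Proof.
elim: w k => [|i w IH] [|k] //; rewrite ?word_op_nil ?star1 ?mul1r ?mulr1 ?subn0 // => wk.
rewrite word_op_cons starM -mulrA star_mul_spread mulrA IH // subSS.
by rewrite -mulrA.
Qed.

Lemma spread_star_mul k l : star (spread k.+1) * spread l.+1 =
  \sum_i S i * (star (spread k) * spread l) * star (S i).
Proof.
rewrite [in X in star X]/= star_sum mulr_suml; apply: eq_bigr => i _.
by rewrite !starM starK -!mulrA star_mul_spread.
Qed.

Lemma exp_word d : S i0 ^+ d = word_op (nseq d i0).
Proof. by elim: d => [|d IH]; rewrite ?word_op_nil // exprS IH -word_op_cons. Qed.

Lemma exp_isometry d : star (S i0 ^+ d) * S i0 ^+ d = 1.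
Proof. by rewrite exp_word word_op_isometry. Qed.

Lemma spread_isometry k : star (spread k) * spread k = 1.
Proof.
elim: k => [|k IH].
  by rewrite /= starM mulrA -(mulrA _ _ (S i0 ^+ r)) exp_isometry mulr1 cuntz_isometry.
rewrite spread_star_mul IH -hS.2; apply: eq_bigr => i _.
by rewrite hS.2 mulr1.
Qed.

Lemma spread_orthogonal_lt k l : (k < l)%N -> (l - k <= r)%N ->
  star (spread k) * spread l = 0.
Proof.
elim: k l => [|k IH] [|l] //; last first.
  rewrite ltnS subSS => kl lr; rewrite spread_star_mul IH // big1 // => i _.
  by rewrite mulr0 mul0r.
move=> _; rewrite subn0 => lr.
(* The induction leaves [k = 0]. As [m <= r], the word [S i0 ^+ r * S i1] starts with [S i0 ^+ m],
   whose adjoint passes through [spread m]. After cancelling [S i0 ^+ (r - m)], the adjoint of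
   [S i1] meets [S i0], since [m > 0]. *)
set m := l.+1 in lr *.
have hm : star (S i0 ^+ m) * spread m = spread 0 * star (S i0 ^+ m).
  by rewrite exp_word star_word_spread size_nseq // subnn.
have e0 : spread 0 = S i0 ^+ m * S i0 ^+ (r - m) * S i1.
  by rewrite -exprD subnKC.
have e0' : spread 0 = S i0 ^+ (r - m) * S i0 ^+ m * S i1.
  by rewrite -exprD subnK.
rewrite {1}e0 !starM -!mulrA hm e0' -!mulrA (mulrA (star (S i0 ^+ (r - m)))).
rewrite exp_isometry mul1r /m exprS -!mulrA mulrA cuntz_orthogonal ?mul0r //.
by rewrite eq_sym.
Qed.

Lemma spread_orthogonal k l : (k <= r)%N -> (l <= r)%N ->
  star (spread k) * spread l = (k == l)%:R.
Proof.
move=> kr lr; case: ltngtP => [kl|lk|->]; last by rewrite spread_isometry.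
  by rewrite spread_orthogonal_lt // (leq_trans (leq_subr _ _)).
rewrite -[LHS]starK starM starK spread_orthogonal_lt ?star0 //.
by rewrite (leq_trans (leq_subr _ _)).
Qed.

(** Both words move outwards past the isometries, leaving in the middle a product of
    [spread (k - size u)] and [spread (l - size v)] that is 0 or 1 by orthogonality. The test is
    stated with sums to avoid truncated subtraction. *)
Lemma spread_sandwich k l u v : (k <= r)%N -> (l <= r)%N ->
  (size u <= k)%N -> (size v <= l)%N ->
  star (spread k) * (word_op u * star (word_op v)) * spread l =
  if k + size v == l + size u then word_op u * star (word_op v) else 0.
Proof.
move=> kr lr uk vl; rewrite -!mulrA star_word_spread // mulrA.
rewrite -[X in X * _]starK starM starK star_word_spread // starM starK.
rewrite -mulrA (mulrA (star (spread _))) spread_orthogonal; first 1 last.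
- by rewrite (leq_trans (leq_subr _ _)).
- by rewrite (leq_trans (leq_subr _ _)).
have -> : (k - size u == l - size v)%N = (k + size v == l + size u)%N by lia.
by case: eqP => _; rewrite ?mul1r // mul0r mulr0.
Qed.

(* Sandwiching between [star (spread k)] and [spread l] keeps exactly the words
   with [size v - size u = l - k]. *)
Lemma graded_sum k a : (2 * k <= r)%N -> word_span S k a ->
  a = \sum_(d < k.+1) star (spread k) * a * spread (k + d) +
      \sum_(d < k) star (spread (k + d.+1)) * a * spread k.
Proof.
move=> kr; elim=> [|b c _ hb _ hc|z b _ hb|u v uk vk].
- by rewrite !big1 ?addr0 // => d _; rewrite mulr0 mul0r.
- rewrite {1}hb {1}hc addrACA -!big_split /=.
  by congr (_ + _); apply: eq_bigr => d _; rewrite mulrDr mulrDl.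
- rewrite {1}hb scalerDr !scaler_sumr; congr (_ + _); apply: eq_bigr => d _;
  by rewrite -scalerAr -scalerAl.
have dk (d : 'I_k.+1) : (d <= k)%N by rewrite -ltnS.
under eq_bigr => d _.
  rewrite spread_sandwich //; first last.
  - by rewrite (leq_trans vk) // leq_addr.
  - by have := dk d; lia.
  - by lia.
  have -> : (k + size v == k + d + size u)%N = (size v == d + size u)%N by lia.
  over.
under [X in _ + X]eq_bigr => d _.
  rewrite spread_sandwich //; first last.
  - by rewrite (leq_trans uk) // leq_addr.
  - by lia.
  - by case: d => /= d; lia.
  have -> : (k + d.+1 + size v == k + size u)%N = (d.+1 + size v == size u)%N by lia.
  over.
case: (leqP (size u) (size v)) => uv.
  have dlt : (size v - size u < k.+1)%N by lia.
  rewrite (bigD1 (Ordinal dlt)) //= subnK // eqxx !big1 ?addr0 // => d.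
    by move=> _; case: eqP => //; lia.
  by move=> /eqP dn; case: eqP => // e; case: dn; apply: val_inj => /=; lia.
have dlt : (size u - size v - 1 < k)%N by lia.
rewrite big1 ?add0r => [|d _]; last by case: eqP => //; lia.
rewrite (bigD1 (Ordinal dlt)) //= big1 ?addr0 => [|d /eqP dn].
  by case: eqP => //; lia.
by case: eqP => // e; case: dn; apply: val_inj => /=; lia.
Qed.

(** The surviving terms have [size v = size u + d]; the isometry [S i0 ^+ d] on the left balances
    the two lengths without changing the norm. *)
Lemma core_graded k d a : (2 * k <= r)%N -> (d <= k)%N -> word_span S k a ->
  core S (k + d) (S i0 ^+ d * (star (spread k) * a * spread (k + d))).
Proof.
move=> kr dk; elim=> [|b c _ hb _ hc|z b _ hb|u v uk vk].
- by rewrite mulr0 mul0r mulr0; exact: core0.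
- by rewrite mulrDr mulrDl mulrDr; exact: coreD.
- by rewrite -scalerAr -scalerAl -scalerAr; exact: coreZ.
rewrite spread_sandwich //; [|lia..].
case: eqP => [e|_]; last by rewrite mulr0; exact: core0.
rewrite mulrA exp_word -word_op_cat; apply: core_word => //;
  rewrite size_cat size_nseq; lia.
Qed.

End Compression.

(** * Morphisms out of the Cuntz algebra are injective *)

Section Injectivity.
Context {R : realType} {A B : cstarAlgType R} {N : nat} (S : 'I_N -> A).
Hypothesis hS : cuntz_family S.
Variable phi : {lrmorphism A -> B}.
Hypothesis sphi : star_morphism phi.
Implicit Types (a x X : A).

Lemma cnorm_morph_isometry s : star s * s = 1 -> cnorm (phi s) = 1.
Proof. by move=> e; apply: cnorm_isometry; rewrite -sphi -rmorphM e rmorph1. Qed.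

(** A crude bound summing the [N * N] matrix entries at each level. What matters is that the
    constant depends on [k] alone. *)
Lemma core_cnorm_bound k X : core S k X -> cnorm X <= ((N * N) ^ k)%:R * cnorm (phi X).
Proof.
elim: k X => [|k IH] X.
  by case=> c ->; rewrite linearZ /= !cnormZ (rmorph1 phi) !cnorm1 mul1r.
move=> hX; rewrite [X in cnorm X](cuntz_expand hS).
apply: (le_trans (cnorm_sum _ _)).
pose K : R := ((N * N) ^ k)%:R * cnorm (phi X).
have le1 i j : cnorm (S i * (star (S i) * X * S j) * star (S j)) <= K.
  apply: (le_trans (cnormM _ _)); rewrite cnorm_starE.
  rewrite (cnorm_isometry (cuntz_isometry hS j)) mulr1.
  rewrite cnorm_isometry_mul ?cuntz_isometry //.
  apply: (le_trans (IH _ (hX i j))); rewrite /K ler_wpM2l ?ler0n //.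
  rewrite !rmorphM /=; apply: (le_trans (cnormM _ _)).
  rewrite (cnorm_morph_isometry (cuntz_isometry hS j)) mulr1.
  apply: (le_trans (cnormM _ _)).
  by rewrite sphi cnorm_starE (cnorm_morph_isometry (cuntz_isometry hS i)) mul1r.
apply: (@le_trans _ _ (\sum_(i < N) \sum_(j < N) K)).
  by apply: ler_sum => i _; apply: (le_trans (cnorm_sum _ _)); apply: ler_sum.
by rewrite !sumr_const !card_ord -mulrnA expnS natrM -mulrA -/K mulr_natl.
Qed.

(* Norms of powers of [star x * x] recover the norm of [x], so a bound that
   grows at most linearly with the power upgrades to a contraction. *)
Lemma cnorm_le_of_power_bound x (c : R) : 0 <= c ->
  (forall n : nat, cnorm ((star x * x) ^+ (2 ^ n)) <=
     (c * (2 ^ n)%:R + 1) * cnorm (phi ((star x * x) ^+ (2 ^ n)))) ->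
  cnorm x <= cnorm (phi x).
Proof.
move=> c0 H; rewrite -(@ler_pXn2r _ 2) ?nnegrE ?cnorm_ge0 //.
rewrite -!cnorm_star -sphi -rmorphM.
apply: (le_of_exp_le_linear _ _ c0); rewrite ?cnorm_ge0 // => n.
rewrite -!cnorm_exp_sa -?rmorphXn //; first by rewrite -sphi starM starK.
by rewrite starM starK.
Qed.

(** The core of level [k] is a star-algebra, so all powers of [star X * X] obey the crude bound with
    the same constant. *)
Lemma core_cnorm_le k X : core S k X -> cnorm X <= cnorm (phi X).
Proof.
move=> hX; apply: (@cnorm_le_of_power_bound _ ((N * N) ^ k)%:R) => // n.
have hP : core S k ((star X * X) ^+ (2 ^ n)).
  by apply: coreX => //; apply: coreM => //; apply: core_star.
apply: (le_trans (core_cnorm_bound hP)); rewrite ler_wpM2r ?cnorm_ge0 //.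
apply: (@le_trans _ _ (((N * N) ^ k)%:R * (2 ^ n)%:R)); last by rewrite lerDl.
by rewrite ler_peMr // ler1n expn_gt0.
Qed.

Hypothesis N2 : (2 <= N)%N.

Lemma word_span_cnorm_bound k a : word_span S k a ->
  cnorm a <= (2 * k + 1)%:R * cnorm (phi a).
Proof.
move=> ha; pose i0 : 'I_N := Ordinal (ltnW N2); pose i1 : 'I_N := Ordinal N2.
have i01 : i0 != i1 by [].
(* The parameter [2 * k] suffices because the indices used below run up to [k + k]. *)
pose W := spread S i0 i1 (2 * k).
have Wn l : cnorm (phi (W l)) = 1.
  by apply: cnorm_morph_isometry; exact: spread_isometry.
have graded_le d b : (d <= k)%N -> word_span S k b ->
    cnorm (star (W k) * b * W (k + d)%N) <= cnorm (phi b).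
  move=> dk hb; rewrite -(cnorm_isometry_mul _ (exp_isometry hS i0 d)).
  have hc := core_graded hS i01 (leqnn _) dk hb.
  apply: (le_trans (core_cnorm_le hc)).
  rewrite rmorphM /=; apply: (le_trans (cnormM _ _)).
  rewrite (cnorm_morph_isometry (exp_isometry hS i0 d)) mul1r.
  rewrite !rmorphM /=; apply: (le_trans (cnormM _ _)); rewrite Wn mulr1.
  by apply: (le_trans (cnormM _ _)); rewrite sphi cnorm_starE Wn mul1r.
rewrite {1}(graded_sum hS i01 (leqnn _) ha) -/W.
apply: (le_trans (cnormD _ _)).
have -> : (2 * k + 1)%:R * cnorm (phi a) =
    \sum_(d < k.+1) cnorm (phi a) + \sum_(d < k) cnorm (phi a).
  rewrite !sumr_const !card_ord -mulrnDr mulr_natl; congr (_ *+ _); lia.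
apply: lerD; apply: (le_trans (cnorm_sum _ _)); apply: ler_sum => d _.
  by apply: graded_le => //; rewrite -ltnS.
(* The remaining components are adjoints of those already bounded, taken for [star a]. *)
rewrite -cnorm_starE !starM starK mulrA.
apply: (le_trans (graded_le _ _ _ (word_span_star ha))); first by case: d.
by rewrite sphi cnorm_starE.
Qed.

Lemma word_span_cnorm_le k a : word_span S k a -> cnorm a <= cnorm (phi a).
Proof.
(* The power [2 ^ n] of [star a * a] has degree at most [(k + k) * 2 ^ n], so the number of its
   components is linear in [2 ^ n]. *)
move=> ha; apply: (@cnorm_le_of_power_bound _ (2 * (k + k))%:R) => // n.
have hP := word_spanX hS (2 ^ n) (word_spanM hS (word_span_star ha) ha).
apply: (le_trans (word_span_cnorm_bound hP)).
by rewrite natrD -natrM mulnA.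
Qed.

Lemma cuntz_morphism_injective : generates (range S) -> injective phi.
Proof.
move=> gen; suff ker x : phi x = 0 -> x = 0.
  move=> x y e; apply/eqP; rewrite -subr_eq0; apply/eqP/ker.
  by rewrite rmorphB /= e subrr.
move=> x0; apply: cnorm_small_eq0 => e e0; have e2 : 0 < e / 2 by rewrite divr_gt0.
have [k [a [ha xa]]] := word_span_dense hS gen x e2.
(* As [phi x = 0], [phi a] and [phi (x - a)] differ only by sign, and [phi] is contractive. *)
have na : cnorm a <= cnorm (x - a).
  apply: (le_trans (word_span_cnorm_le ha)).
  rewrite -cnormN (_ : - phi a = phi (x - a)); last by rewrite rmorphB /= x0 sub0r.
  exact: star_morphism_contractive.
rewrite -(subrK a x); apply: (le_lt_trans (cnormD _ _)); lra.
Qed.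

End Injectivity.

Definition bfs_word N (W : Type) (f : bfs N W) (w : seq 'I_N) (x : W) : W :=
  foldr f x w.

(** * Branches of the algorithm as words in the Farey branches *)

Section FareyWords.
Context {R : realType}.
Implicit Types (w : seq 'I_2) (x : irr R) (p q : int).

Lemma flipK : involutive (@flip R).
Proof. by move=> x; apply: val_inj; rewrite /= subKr. Qed.

(* The Moebius map with [0 |-> p / q] and [1 |-> p' / q'].  Unless
   [q = q' = 1], unimodularity puts both values on the same side of [1 / 2], and
   factoring out the branch of the Farey map with that image decreases
   [q + q']. *)
Lemma farey_factorization (n : nat) p q p' q' :
  0 <= p <= q -> 0 <= p' <= q' -> 0 < q -> 0 < q' ->
  p' * q - p * q' = 1 \/ p' * q - p * q' = -1 -> q + q' <= n%:Z ->
  exists w (s : bool), forall x,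
    val (bfs_word (scfa_bfs (FB R)) w (if s then flip x else x)) =
    ((p'%:~R - p%:~R) * val x + p%:~R) / ((q'%:~R - q%:~R) * val x + q%:~R).
Proof.
elim: n p q p' q' => [|n IH] p q p' q' /andP[p0 pq] /andP[p0' pq'] q0 q0' det le_n.
  by exfalso; lia.
(* The expression is a convex combination of [u] and [v]. *)
have den_gt0 (u v : int) x : 0 < u -> 0 < v ->
    0 < (v%:~R - u%:~R) * val x + u%:~R :> R.
  move=> u0 v0; have [/andP[x0 x1] xN] := irrP x.
  have u0R : 0 < u%:~R :> R by rewrite ltr0z.
  have v0R : 0 < v%:~R :> R by rewrite ltr0z.
  nra.
case: (boolP ((q == 1) && (q' == 1))) => [/andP[/eqP q1 /eqP q1']|qn1].
  subst q q'; have [[-> ->]|[-> ->]] : (p = 0 /\ p' = 1) \/ (p = 1 /\ p' = 0) by lia.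
    by exists [::], false => x; rewrite /= mulr1z mulr0z; field.
  by exists [::], true => x; rewrite /= mulr1z mulr0z; field.
have [[lo lo']|[hi hi']] : (2 * p <= q /\ 2 * p' <= q') \/ (q <= 2 * p /\ q' <= 2 * p').
  by nia.
(* The inverse branch [y / (1 - y)] sends [p / q] to [p / (q - p)]. *)
- have [||||||w [s ws]] := IH p (q - p) p' (q' - p'); try lia; try nia.
  exists (ord0 :: w), s => x; rewrite /= -/(bfs_word _ _ _) FB_moebius0 ws.
  have d2 := den_gt0 q q' x q0 q0'.
  have : 0 < ((q' - p')%:~R - (q - p)%:~R) * val x + (q - p)%:~R :> R.
    by apply: den_gt0; lia.
  rewrite !intrB => d1; rewrite -[sval x]/(val x); field.
  by rewrite !gt_eqF //; apply: le_lt_trans d2 => //; lra.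
(* The inverse branch [2 - 1 / y] sends [p / q] to [(2 * p - q) / p]. *)
- have [||||||w [s ws]] := IH (2 * p - q) p (2 * p' - q') p'; try lia; try nia.
  exists (ord_max :: w), s => x; rewrite /= -/(bfs_word _ _ _) FB_moebius1 ws.
  have d1 : 0 < (p'%:~R - p%:~R) * val x + p%:~R :> R by apply: den_gt0; lia.
  have d2 := den_gt0 q q' x q0 q0'.
  rewrite !intrB !intrM -[sval x]/(val x); field.
  rewrite !gt_eqF //; apply: le_lt_trans d2 => //; lra.
Qed.
End FareyWords.

Section FareyWordsSCFA.
Context {R : realType}.

(** The branch sends 0 to [b / d] and 1 to [(a + b) / (c + d)]. After a common change of sign both
    denominators are positive and [farey_factorization] applies. *)
Lemma scfa_farey_word N (h : @scfa R N) (i : 'I_N) :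
  exists w (s : bool), forall x,
    scfa_bfs h i x = bfs_word (scfa_bfs (FB R)) w (if s then flip x else x).
Proof.
pose a := h i ord0 ord0; pose b := h i ord0 ord_max.
pose c := h i ord_max ord0; pose d := h i ord_max ord_max.
have det : a * d - b * c = 1 \/ a * d - b * c = -1.
  by have := scfa_det h i; rewrite moebius_detE.
have den (x : R) : 0 <= x <= 1 -> c%:~R * x + d%:~R != 0 := scfa_den h i (x := x).
have in01 (x : R) : 0 <= x <= 1 ->
    0 <= (a%:~R * x + b%:~R) / (c%:~R * x + d%:~R) <= 1 := scfa_in01 h i (x := x).
have d_neq0 : d != 0.
  by have := den 0; rewrite mulr0 add0r lexx ler01 intr_eq0 => /(_ isT).
have cd_neq0 : c + d != 0.
  by have := den 1; rewrite mulr1 lexx ler01 -intrD intr_eq0 => /(_ isT).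
have same_sign : (0 < d /\ 0 < c + d) \/ (d < 0 /\ c + d < 0).
  have [|opp] : ((0 < d /\ 0 < c + d) \/ (d < 0 /\ c + d < 0)) \/ (d * (c + d) < 0).
  - by nia.
  - by [].
  exfalso; have c_neq0 : c != 0 by nia.
  have cR : c%:~R != 0 :> R by rewrite intr_eq0.
  have cc0 : 0 < (c * c)%:~R :> R by rewrite ltr0z; nia.
  (* With opposite signs at the endpoints the denominator would vanish at [- d / c], inside the unit
     interval. *)
  have root01 : 0 <= (- d%:~R / c%:~R : R) <= 1.
    have -> : - d%:~R / c%:~R = (- (c * d))%:~R / (c * c)%:~R :> R.
      by rewrite intrN !intrM; field.
    rewrite ler_pdivlMr // ler_pdivrMr // mul0r mul1r ler0z ler_int.
    by apply/andP; split; nia.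
  by have := den (- d%:~R / c%:~R) root01; rewrite mulrCA divff // mulr1 addNr eqxx.
pose e : int := if 0 < d then 1 else -1.
have [ed ecd] : 0 < e * d /\ 0 < e * (c + d) by rewrite /e; case: ifP; lia.
have e2 : e * e = 1 by rewrite /e; case: ifP.
have bound (n m : int) : 0 <= (n%:~R / m%:~R : R) <= 1 -> 0 < e * m ->
    0 <= e * n <= e * m.
  move=> /andP[t0 t1] em; rewrite -(ler0z R) -(ler_int R).
  have mR : 0 < (e * m)%:~R :> R by rewrite ltr0z.
  have m0 : m%:~R != 0 :> R by rewrite intr_eq0; nia.
  have -> : (e * n)%:~R = n%:~R / m%:~R * (e * m)%:~R :> R.
    by rewrite !intrM; field.
  by rewrite mulr_ge0 ?(ltW mR) //= ler_piMl // ltW.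
have [||||||w [s ws]] := @farey_factorization R (absz (e * d + e * (c + d)))
  (e * b) (e * d) (e * (a + b)) (e * (c + d)).
- by apply: bound => //; have := in01 0; rewrite !mulr0 !add0r; apply; rewrite lexx ler01.
- apply: bound => //; have := in01 1; rewrite !mulr1 -!intrD; apply.
  by rewrite lexx ler01.
- by [].
- by [].
- have -> : e * (a + b) * (e * d) - e * b * (e * (c + d)) = (e * e) * (a * d - b * c).
    by ring.
  by rewrite e2 mul1r.
- by lia.
exists w, s => x; apply: val_inj; rewrite ws /= /moebius /moebius_den -/a -/b -/c -/d.
rewrite -[sval x]/(val x).
have eR : e%:~R != 0 :> R by rewrite intr_eq0; apply: contraPneq e2 => ->.
rewrite !intrM !intrD.
have -> : (e%:~R * (a%:~R + b%:~R) - e%:~R * b%:~R) * val x + e%:~R * b%:~R =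
  e%:~R * (a%:~R * val x + b%:~R) :> R by ring.
have -> : (e%:~R * (c%:~R + d%:~R) - e%:~R * d%:~R) * val x + e%:~R * d%:~R =
  e%:~R * (c%:~R * val x + d%:~R) :> R by ring.
by rewrite invfM mulrACA divff // mul1r.
Qed.

End FareyWordsSCFA.

(** * Complete prefix codes give Cuntz families *)

Section PrefixCodes.
Context {M : nat} {W : Type} (f : bfs M W).
Implicit Types (u v w : seq 'I_M) (x y : W).

Lemma bfs_neq i j x y : f i x = f j y -> i = j.
Proof.
move=> e; have := @bfs_disjoint _ _ f i j I I; apply.
by exists (f i x); split; [exists x|rewrite e; exists y].
Qed.

Lemma bfs_word_cat u v x : bfs_word f (u ++ v) x = bfs_word f u (bfs_word f v x).
Proof. exact: foldr_cat. Qed.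

Lemma bfs_word_prefix u v x y : bfs_word f u x = bfs_word f v y ->
  (size u <= size v)%N -> exists w, v = u ++ w.
Proof.
elim: u v => [|i u IH] [|j v] //=; [by exists [::]|by exists (j :: v)|].
move=> e; have ij := bfs_neq e; subst j => uv.
by have [w ->] := IH _ (@bfs_inj _ _ f i _ _ e) uv; exists w.
Qed.

Context {R : realType} {A : cstarAlgType R} (S : 'I_M -> A).
Hypothesis hS : cuntz_family S.

Lemma star_word_mul_comparable u v : star (word_op S u) * word_op S v <> 0 ->
  (exists w, v = u ++ w) \/ (exists w, u = v ++ w).
Proof.
elim: u v => [|i u IH] [|j v] nz.
- by left; exists [::].
- by left; exists (j :: v).
- by right; exists (i :: u).
move: nz; rewrite !word_op_cons starM mulrA -(mulrA (star _)) hS.1.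
have [<-|_] := eqVneq i j; last by rewrite mulr0 mul0r.
by rewrite mulr1 => /IH [[w ->]|[w ->]]; [left|right]; exists w.
Qed.

(** The range projections of the words of length [k] sum to 1; the induction removes the last
    letter. *)
Lemma word_op_separating k a :
  (forall w, size w = k -> a * word_op S w = word_op S w) -> a = 1.
Proof.
elim: k a => [|k IH] a H.
  by have := H [::] erefl; rewrite word_op_nil mulr1.
apply: IH => w wk; rewrite -[RHS]mulr1 -[a * _]mulr1 -hS.2 !mulr_sumr.
apply: eq_bigr => i _; rewrite !mulrA; congr (_ * _).
have := H (w ++ [:: i]); rewrite size_cat wk addn1 => /(_ erefl).
by rewrite word_op_cat word_op_cons word_op_nil mulr1 mulrA.
Qed.

Context {N : nat} (c : 'I_N -> seq 'I_M) (x0 : W).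
Hypothesis c_disjoint : forall i j x y,
  bfs_word f (c i) x = bfs_word f (c j) y -> i = j.
Hypothesis c_cover : forall x, exists i y, bfs_word f (c i) y = x.

(** If one code word were a prefix of another, their ranges would share a point built from [x0]. For
    completeness, take [t] of maximal code length: the point that [t] makes of [x0] lies in the
    range of some [c i], so [c i] is a prefix of [t] and the sum of range projections fixes
    [word_op S t]. *)
Lemma cuntz_family_code : cuntz_family (fun i => word_op S (c i)).
Proof.
have orth i j : star (word_op S (c i)) * word_op S (c j) = (i == j)%:R.
  have [<-|ij] := eqVneq i j; first exact: word_op_isometry.
  apply: contrapT => /star_word_mul_comparable[] [w e]; move/eqP: ij; apply.
    by apply: (c_disjoint (x := bfs_word f w x0) (y := x0)); rewrite e bfs_word_cat.
  by apply: (c_disjoint (x := x0) (y := bfs_word f w x0)); rewrite e bfs_word_cat.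
split=> //.
apply: (@word_op_separating (\max_i size (c i))) => t tk.
have [i [y e]] := c_cover (bfs_word f t x0).
have [|w tE] := bfs_word_prefix e; first by rewrite tk; exact: leq_bigmax.
rewrite tE word_op_cat mulrA mulr_suml (bigD1 i) //= big1 ?addr0 => [|j ji].
  by rewrite -(mulrA _ (star _)) orth eqxx mulr1.
by rewrite -(mulrA _ (star _)) orth (negbTE ji) mulr0.
Qed.

End PrefixCodes.

(** * Matrix coefficients of representations *)

Section Ell2Theory.
Context {R : realType} {W : choiceType}.
Local Notation H := (@ell2 R W).
Implicit Types (f g : H) (v w : W).

Lemma ell2D f g w : (f + g) w = f w + g w.
Proof. exact: (congr1 (@^~ w) (GRing.valD f g)). Qed.

Lemma ell2Z (k : R[i]) f w : (k *: f) w = k * f w.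
Proof. reflexivity. Qed.

Lemma esum_single (F : W -> \bar R) v : (forall w, 0 <= F w)%E ->
  (forall w, w != v -> F w = 0%E) -> (\esum_(w in [set: W]) F w = F v)%E.
Proof.
move=> F0 Fv; rewrite (esumID [set v]) // setTI esum_set1 // esum1 ?adde0 //.
by move=> w [_ /= /eqP]; exact: Fv.
Qed.

Lemma rsum_single (g : W -> R) v : (forall w, w != v -> g w = 0) -> rsum g = g v.
Proof.
move=> gv; rewrite /rsum !(@esum_single _ v) /=.
- by case: (leP (g v) 0) => ?; case: (leP (- g v) 0) => ?; lra.
- by move=> w; rewrite lee_fin le_max lexx orbT.
- by move=> w /gv ->; rewrite oppr0 maxxx.
- by move=> w; rewrite lee_fin le_max lexx orbT.
- by move=> w /gv ->; rewrite maxxx.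
Qed.

Lemma ell2_inner_basis f v : ell2_inner f (ell2_basis v) = f v.
Proof.
rewrite /ell2_inner /csum !(@rsum_single _ v) /=.
- by rewrite eqxx rmorph1 mulr1; case: (f v).
- by move=> w /negbTE ->; rewrite rmorph0 mulr0.
- by move=> w /negbTE ->; rewrite rmorph0 mulr0.
Qed.

Lemma ell2_inner_self f : ell2_inner f f = (ell2norm f ^+ 2)%:C.
Proof.
have E w : f w * (f w)^* = (normc (f w) ^+ 2)%:C.
  case: (f w) => a b; rewrite /normc sqr_sqrtr ?addr_ge0 ?sqr_ge0 //.
  by apply/eqP; rewrite eq_complex /=; apply/andP; split; apply/eqP; ring.
rewrite /ell2norm sqr_sqrtr; last first.
  by apply: fine_ge0; apply: esum_ge0 => w _; rewrite lee_fin sqr_ge0.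
rewrite /ell2_inner /csum /rsum; congr (_ +i* _); last first.
  rewrite !esum1 ?subrr // => w _; rewrite E /= ?oppr0 maxxx //.
rewrite [X in _ - fine X]esum1 ?subr0; last first.
  by move=> w _; rewrite E /= max_r // oppr_le0 sqr_ge0.
congr fine; apply: eq_esum => w _; rewrite E /= max_l // sqr_ge0 //.
Qed.

Lemma normc_le_ell2norm f w : normc (f w) <= ell2norm f.
Proof.
have nf : 0 <= normc (f w) by case: (f w) => a b; rewrite /normc sqrtr_ge0.
rewrite -(ger0_norm nf) -sqrtr_sqr /ell2norm ler_wsqrtr //.
have := ell2P f; rewrite unfold_in => fin.
have pos : (0 <= sqsum f)%E by apply: esum_ge0 => v _; rewrite lee_fin sqr_ge0.
rewrite -lee_fin fineK; last by rewrite ge0_fin_numE.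
apply: esum_ge; exists [set w]; first by split.
by rewrite fsbig_set1.
Qed.

Lemma ell2_eqP f g : (forall w, f w = g w) -> f = g.
Proof. by move=> e; apply: val_inj; apply: funext => w; exact: e. Qed.

Context {A : cstarAlgType R} (pi : A -> {linear H -> H}).
Hypothesis hpi : representation pi.
Implicit Types (a u : A) (xi : H).

Lemma rep_coef a xi w :
  pi a xi w = ell2_inner xi (pi (star a) (ell2_basis w)).
Proof. by rewrite -(rep_star hpi) starK ell2_inner_basis. Qed.

Lemma rep_unitary_norm u xi : star u * u = 1 -> ell2norm (pi u xi) = ell2norm xi.
Proof.
move=> uu; apply/eqP; rewrite -(@eqrXn2 _ 2) ?sqrtr_ge0 //.
have : ell2_inner (pi u xi) (pi u xi) = ell2_inner xi xi.
  by rewrite -{1}(starK u) (rep_star hpi) -(repM hpi) uu (rep1 hpi).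
by rewrite !ell2_inner_self => -[->].
Qed.

(** Continuity of coefficients in [a], uniform in [w]: the four unitaries of the decomposition
    preserve the norm of [xi], and each carries the weight [r / 2]. *)
Lemma rep_coef_bound a r xi w : cnorm a < r ->
  normc (pi a xi w) <= 2 * r * ell2norm xi.
Proof.
move=> ar; have r0 : 0 < r by apply: le_lt_trans ar; exact: cnorm_ge0.
have [u [v [uu vv uu' vv' ->]]] := unitary_decomposition ar.
have half (z : A) : star z * z = 1 -> z * star z = 1 ->
    normc (pi (z + star z) xi w) <= 2 * ell2norm xi.
  move=> z1 z2; rewrite (repD hpi) ell2D; apply: (le_trans (le_normcD _ _)).
  have h1 := normc_le_ell2norm (pi z xi) w.
  have h2 := normc_le_ell2norm (pi (star z) xi) w.
  move: h1 h2; rewrite !rep_unitary_norm ?starK //; lra.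
rewrite (repD hpi) ell2D; apply: (le_trans (le_normcD _ _)).
rewrite !(repZ hpi) !ell2Z !normcM normc_i mul1r normc_real ger0_norm; last first.
  by rewrite divr_ge0 // ltW.
have := half _ uu uu'; have := half _ vv vv'; nra.
Qed.

End Ell2Theory.

(** By [rep_coef], agreement of [a] on basis vectors gives agreement of [star a] on all vectors. The
    set of elements where the representations agree is then a closed star-subalgebra. *)
Lemma rep_eq_generators (R : realType) (W : choiceType) (A : cstarAlgType R)
  (I : Type) (S : I -> A) (pi1 pi2 : A -> {linear ell2 W -> @ell2 R W}) :
  representation pi1 -> representation pi2 -> generates (range S) ->
  (forall i w, pi1 (S i) (ell2_basis w) = pi2 (S i) (ell2_basis w)) ->
  forall a xi, pi1 a xi = pi2 a xi.
Proof.
move=> h1 h2 gen eqS.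
have eq_star a : (forall w, pi1 a (ell2_basis w) = pi2 a (ell2_basis w)) ->
    forall xi, pi1 (star a) xi = pi2 (star a) xi.
  move=> e xi; apply: ell2_eqP => w.
  by rewrite (rep_coef h1) (rep_coef h2) !starK e.
pose P := [set a | forall xi, pi1 a xi = pi2 a xi].
suff PT : P = setT by move=> a; have : P a by rewrite PT.
apply: gen.
- split=> [a b ha hb xi|k a ha xi|a b ha hb xi|a ha].
  + by rewrite (repD h1) (repD h2) ha hb.
  + by rewrite (repZ h1) (repZ h2) ha.
  + by rewrite (repM h1) (repM h2) ha hb.
  + by apply: eq_star => w; exact: ha.
- move=> u l hu ul xi; apply: ell2_eqP => w.
  have D (c : R) : 0 < c -> normc (pi1 l xi w - pi2 l xi w) <= c * (4 * ell2norm xi).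
    move=> c0; have [n /(_ n (leqnn n)) hn] := ul _ c0.
    have -> : pi1 l xi w - pi2 l xi w = pi2 (u n - l) xi w - pi1 (u n - l) xi w.
      have dec pi : representation pi -> pi (u n - l) xi w = pi (u n) xi w - pi l xi w.
        move=> h; rewrite (repD h) ell2D -[- l]scaleN1r (repZ h) ell2Z.
        by rewrite mulN1r.
      by rewrite (dec _ h1) (dec _ h2) hu; ring.
    apply: (le_trans (le_normcD _ _)); rewrite normcN.
    have := rep_coef_bound h1 xi w hn; have := rep_coef_bound h2 xi w hn; nra.
  apply/eqP; rewrite -subr_eq0; apply/eqP; apply: eq0_normc; apply/eqP.
  rewrite eq_le; apply/andP; split; last first.
    by case: (_ - _) => x y; rewrite /normc sqrtr_ge0.
  apply/ler_addgt0Pl => e e0; rewrite addr0.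
  have x0 : 0 <= ell2norm xi by rewrite sqrtr_ge0.
  have c0 : 0 < e / (4 * ell2norm xi + 1) by rewrite divr_gt0 //; lra.
  apply: (le_trans (D _ c0)); rewrite mulrAC ler_pdivrMr; last by lra.
  by rewrite ler_pM2l //; lra.
(* Passing to the adjoint twice upgrades agreement on basis vectors to agreement everywhere. *)
- move=> _ [i _ <-] xi; rewrite -(starK (S i)); apply: (eq_star (star (S i))) => w.
  by apply: eq_star => v; exact: eqS.
Qed.

Lemma bfs_induces_word (R : realType) N (W : choiceType) (A : cstarAlgType R)
  (S : 'I_N -> A) (f : bfs N W) (pi : A -> {linear ell2 W -> @ell2 R W}) :
  representation pi -> bfs_induces S f pi ->
  forall u w, pi (word_op S u) (ell2_basis w) = ell2_basis (bfs_word f u w).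
Proof.
move=> hpi ind; elim=> [|i u IH] w; first by rewrite word_op_nil (rep1 hpi).
by rewrite word_op_cons (repM hpi) IH ind.
Qed.

(** Provides the base point required by [cuntz_family_code]. *)
Fact sqrt_half_irrational (R : realType) :
  Num.sqrt (1 / 2 : R) \in unit_irrationals.
Proof.
have half0 : 0 <= 1 / 2 :> R by lra.
have sq : Num.sqrt (1 / 2 : R) ^+ 2 = 1 / 2 by rewrite sqr_sqrtr.
rewrite inE; split.
  have s0 := sqrtr_ge0 (1 / 2 : R); rewrite itv_ccE s0 /=.
  by move: sq; set t := Num.sqrt _ in s0 *; nra.
move=> [q _ e]; move: sq; rewrite -e -rmorphXn /=.
have -> : (1 / 2 : R) = ratr (1 / 2) by rewrite fmorph_div rmorph1 rmorph_nat.
move/fmorph_inj; rewrite -(divq_num_den q) => eq.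
have d0 : (denq q)%:~R != 0 :> rat by rewrite intr_eq0 denq_neq0.
have {eq} : 2 * numq q ^+ 2 = denq q ^+ 2.
  apply: (@intr_inj rat); rewrite intrM !rmorphXn /=.
  have -> : (numq q)%:~R = (numq q)%:~R / (denq q)%:~R * (denq q)%:~R :> rat.
    by rewrite divfK.
  by rewrite exprMn eq mulrA mul1r mulfV // mul1r.
move/(congr1 absz); rewrite abszM !abszX /= => eN.
have n0 : (0 < `|numq q|)%N.
  rewrite lt0n; apply/eqP => z; move: eN; rewrite z => /esym/eqP.
  by rewrite muln0 expn_eq0 absz_eq0 denq_eq0.
(* The exponent of 2 is odd on the left and even on the right. *)
have := congr1 (fun m => odd (logn 2 m)) eN.
by rewrite lognM ?expn_gt0 ?n0 // !lognX /= oddD !oddM.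
Qed.

Definition sqrt_half_irr {R : realType} : irr R :=
  exist _ (Num.sqrt (1 / 2)) (sqrt_half_irrational R).

(** * Assembly of the embedding *)

Theorem theorem3 (R : realType) (N : nat) (h : @scfa R N)
  (ON : cstarAlgType R) (S : 'I_N -> ON) (hON : cuntz_algebra S)
  (O2 : cstarAlgType R) (S2 : 'I_2 -> O2) (hO2 : cuntz_algebra S2)
  (theta : {lrmorphism O2 -> O2}) (htheta : flip_flop S2 theta)
  (CP : cstarAlgType R) (iota : {lrmorphism O2 -> CP}) (U : CP)
  (hCP : crossed_product_Z2 theta iota U)
  (piF : ON -> {linear ell2 (irr R) -> @ell2 R (irr R)})
  (hpiF : representation piF)
  (hpiFS : bfs_induces S (scfa_bfs h) piF)
  (piFB : O2 -> {linear ell2 (irr R) -> @ell2 R (irr R)})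
  (hpiFB : representation piFB)
  (hpiFBS : bfs_induces S2 (scfa_bfs (FB R)) piFB)
  (tpiFB : CP -> {linear ell2 (irr R) -> @ell2 R (irr R)})
  (htpiFB : representation tpiFB)
  (htpiFB_ext : forall a xi, tpiFB (iota a) xi = piFB a xi)
  (htpiFB_U : forall x, tpiFB U (ell2_basis x) = ell2_basis (flip x)) :
  exists psi : {lrmorphism ON -> CP},
    [/\ star_morphism psi,
        injective psi
      & forall a xi, tpiFB (psi a) xi = piF a xi].
Proof.
have [siota _ [UU UU'] _] := crossed_covariant hCP.
have [c Hc] := choice (fun i => scfa_farey_word h i).
have [s {}Hc] := choice Hc.
have hS2 := cuntz_relations hO2.
pose f := scfa_bfs (FB R).
(* The flip is an involution, so it can be moved across: each code word has the same range as its
   branch, and disjointness and covering transfer. *)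
have Hc' i x : bfs_word f (c i) x = scfa_bfs h i (if s i then flip x else x).
  by rewrite Hc; case: (s i); rewrite ?flipK.
have hcode : cuntz_family (fun i => word_op S2 (c i)).
  apply: (cuntz_family_code (f := f) hS2 sqrt_half_irr) => [i j x y|x].
    by rewrite !Hc'; exact: bfs_neq.
  have : [set: irr R] x by []; rewrite -(bfs_cover (scfa_bfs h)).
  move=> [i _ [y _ <-]]; exists i, (if s i then flip y else y).
  by rewrite Hc' -/f; case: (s i); rewrite ?flipK.
pose T i := iota (word_op S2 (c i)) * (if s i then U else 1).
have hT : cuntz_family T.
  (* The right factor of [T i] is unitary, so it cancels in the range projections and in the
     diagonal relations. *)
  have unit_s b : (if b then U else 1) * star (if b then U else 1 : CP) = 1.
    by case: b; rewrite ?star1 ?mulr1.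
  have unit_s' b : star (if b then U else 1 : CP) * (if b then U else 1) = 1.
    by case: b; rewrite ?star1 ?mulr1.
  split=> [i j|].
    rewrite /T starM -siota mulrA -(mulrA (star (if s i then U else 1))) -rmorphM.
    rewrite hcode.1; have [<-|_] := eqVneq i j; last by rewrite rmorph0 mulr0 mul0r.
    by rewrite rmorph1 mulr1 unit_s'.
  rewrite -(rmorph1 iota) -hcode.2 rmorph_sum; apply: eq_bigr => i _.
  by rewrite /T starM mulrA -(mulrA (iota _)) unit_s mulr1 -siota rmorphM.
have [psi [spsi psiS]] := cuntz_universal hON hT.
exists psi; split=> //.
  apply: (cuntz_morphism_injective (cuntz_relations hON) spsi (scfa_size h)).
  exact: cuntz_generates hON.
have hpsi : representation (tpiFB \o psi).
  split=> [a|a b xi|k a xi|a b xi|xi|a xi eta] /=.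
  - exact: rep_bounded htpiFB _.
  - by rewrite rmorphD (repD htpiFB).
  - by rewrite linearZ (repZ htpiFB).
  - by rewrite rmorphM (repM htpiFB).
  - by rewrite rmorph1 (rep1 htpiFB).
  - by rewrite spsi (rep_star htpiFB).
apply: (rep_eq_generators hpsi hpiF (cuntz_generates hON)) => i x /=.
rewrite psiS hpiFS /T (repM htpiFB) Hc.
case: (s i); rewrite ?htpiFB_U ?(rep1 htpiFB) htpiFB_ext;
  exact: (bfs_induces_word hpiFB hpiFBS).
Qed.
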